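(* Let $r\ge 2$ and let $\Gamma$ be a chain of cycles of genus $g$ that is Martens-special for rank $r$. Then $w^r_{g-2+r}(\Gamma)\neq w^{r-(g-2+r)+g-1}_{2g-2-(g-2+r)}(\Gamma)$, i.e. $w^r_{g-2+r}(\Gamma)\neq w^{1}_{g-r}(\Gamma)$.
   Context: A chain of cycles of genus $g\ge 1$ is the metric graph obtained from $g$ metric circles $C_1,\dots,C_g$, with two distinct points $v_i,w_i$ on each $C_i$, by joining $w_i$ to $v_{i+1}$ ($1\le i\le g-1$) by a segment of positive length. Orient each $C_i$ so that the positively oriented arc from $v_i$ to $w_i$ is a shortest arc between them; let $\ell_i$ be the length of $C_i$ and $\ell(v_i,w_i)$ the length of that arc. The torsion profile is $(m_2,\dots,m_{g-1})$: $m_i=0$ if $\ell_i/\ell(v_i,w_i)$ is irrational, otherwise $m_i$ is the smallest positive integer such that $m_i\,\ell(v_i,w_i)$ is an integer multiple of $\ell_i$. Divisors, linear equivalence (via rational functions: continuous piecewise affine functions with integer slopes) and rank are as usual for metric graphs: rank is $-1$ if $D$ is not equivalent to an effective divisor, otherwise the largest $r$ such that for every effective $E$ of degree $r$ some effective $D'\sim D$ has $D'-E$ effective. The Brill–Noether rank $w^r_d(\Gamma)$ is $-1$ if there is no divisor of degree $d$ and rank $\ge r$, and otherwise the largest $w$ such that every effective divisor of degree $w+r$ is contained in some effective divisor of degree $d$ and rank $\ge r$. A chain of cycles of genus $g\ge 2r+3$ is Martens-special for rank $r$ (of type $k\ge 1$) if there exist integers $r+1<j_1<\dots<j_k<g-r$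 with $j_{i+1}-j_i\ge r+1$ for $1\le i\le k-1$ such that $m_{j_i}\ne 2$ for $1\le i\le k$ and $m_i=2$ for all $2\le i\le g-1$ with $i\notin\{j_1,\dots,j_k\}$. *)

(* Defs.v *)
From mathcomp Require Export all_boot all_order all_algebra.
From mathcomp Require Export freeg.
From mathcomp Require Export boolp classical_sets reals topology normedtype.
Export numFieldNormedType.Exports.

Set Implicit Arguments.
Unset Strict Implicit.
Unset Printing Implicit Defensive.

Import Order.TTheory GRing.Theory Num.Theory.
Local Open Scope classical_set_scope.
Local Open Scope ring_scope.

(* The default value -1 is returned only if [A] has no maximum. *)
Definition largest (A : set int) : int :=
  xget (-1) [set m | A m /\ ubound A m].

(* A metric graph, presented by a finite model: the edge [e] is a copy of the
   segment [0, elen e] whose ends 0 and [elen e] are glued to the vertices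
   [esrc e] and [etgt e]; loops and multiple edges are allowed. *)
Record metricGraph (R : realType) := MetricGraph {
  vertex : finType;
  edge : finType;
  esrc : edge -> vertex;
  etgt : edge -> vertex;
  elen : edge -> R;
  elen_gt0 : forall e, 0 < elen e
}.

Section MetricGraph.
Variables (R : realType) (G : metricGraph R).

Definition is_point (p : vertex G + edge G * R) : bool :=
  match p with
  | inl _ => true
  | inr (e, x) => 0 < x < elen e
  end.

(* The points of the metric graph: vertices and interior points of edges. *)
Definition point := {p : vertex G + edge G * R | is_point p}.

Definition vpoint (v : vertex G) : point := exist is_point (inl v) isT.

(* Parametrization of the closed edge [e] by [0, elen e], extended to R by
   the constant values at both ends. *)
Definition epoint (e : edge G) (x : R) : point :=
  if x <= 0 then vpoint (esrc e)
  else insubd (vpoint (etgt e)) (inr (e, x)).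

(* Unit-speed paths (near time 0) leaving [p], one for each tangent direction;
   a loop contributes two directions at its vertex. *)
Definition tangents (p : point) : seq (R -> point) :=
  match val p with
  | inl v => [seq (fun t => epoint e t) | e <- enum (edge G) & esrc e == v]
          ++ [seq (fun t => epoint e (elen e - t))
             | e <- enum (edge G) & etgt e == v]
  | inr (e, x) => [:: (fun t => epoint e (x + t)); (fun t => epoint e (x - t))]
  end.

(* Continuity on [0, l], including at the ends, follows because the affine
   pieces are given on closed intervals. *)
Definition pw_affine_int (l : R) (h : R -> R) : Prop :=
  exists (n : nat) (x : nat -> R) (a : nat -> int),
    [/\ x 0%N = 0, x n = l &
        forall i, (i < n)%N -> x i < x i.+1 /\
          forall t, x i <= t <= x i.+1 ->
            h t = h (x i) + (a i)%:~R * (t - x i)].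

Definition rational_function (f : point -> R) : Prop :=
  forall e : edge G, pw_affine_int (elen e) (f \o epoint e).

Definition outgoing_slope (f : point -> R) (gamma : R -> point) : R :=
  lim ((f (gamma t) - f (gamma 0)) / t @[t --> 0^'+]).

Definition order_at (f : point -> R) (p : point) : R :=
  \sum_(gamma <- tangents p) outgoing_slope f gamma.

Definition divisor := {freeg point / int}.

Definition div_le (D E : divisor) : Prop :=
  forall p, coeff p D <= coeff p E.

Definition effective (D : divisor) : Prop := div_le 0 D.

Definition lin_equiv (D D' : divisor) : Prop :=
  exists2 f : point -> R, rational_function f &
    forall p, (coeff p (D' - D))%:~R = order_at f p.

Definition rank (D : divisor) : int :=
  if `[< exists2 D', lin_equiv D D' & effective D' >] then
    largest [set n : int | forall E, effective E -> deg E = n ->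
      exists D', [/\ lin_equiv D D', effective D' & effective (D' - E)]]
  else -1.

(* The Brill-Noether rank w^r_d. *)
Definition bn_rank (r d : int) : int :=
  if `[< exists2 D, deg D = d & r <= rank D >] then
    largest [set w : int | forall E, effective E -> deg E = w + r ->
      exists D, [/\ effective D, div_le E D, deg D = d & r <= rank D]]
  else -1.

End MetricGraph.

(* Cycles are numbered from 1 to g, and values of the length functions
   outside the indicated ranges are irrelevant.  [cycle_len i] is the length
   of C_i, [arc_len i] that of its positively oriented arc from v_i to w_i,
   and [bridge_len i] that of the segment from w_i to v_(i+1). *)
Record chain_of_cycles (R : realType) (g : nat) := ChainOfCycles {
  cycle_len : nat -> R;
  arc_len : nat -> R;
  bridge_len : nat -> R;
  genus_gt0 : (0 < g)%N;
  arc_len_gt0 : forall i, (1 <= i <= g)%N -> 0 < arc_len i;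
  arc_len_shortest : forall i, (1 <= i <= g)%N ->
    arc_len i <= cycle_len i - arc_len i;
  bridge_len_gt0 : forall i, (1 <= i < g)%N -> 0 < bridge_len i
}.

Section ChainOfCycles.
Variables (R : realType) (g : nat) (C : chain_of_cycles R g).

(* [(i, false)] is v_(i+1) and [(i, true)] is w_(i+1), for 0 <= i < g. *)
Definition chain_vertex : finType := ('I_g * bool)%type.

(* [inl (i, false)] is the positively oriented arc of C_(i+1) from v_(i+1) to
   w_(i+1), [inl (i, true)] is the complementary arc, from w_(i+1) to v_(i+1),
   and [inr i] is the segment from w_(i+1) to v_(i+2), for 0 <= i < g - 1. *)
Definition chain_edge : finType := (('I_g * bool) + 'I_g.-1)%type.

Definition chain_src (e : chain_edge) : chain_vertex :=
  match e with
  | inl ib => ib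
  | inr i => (widen_ord (leq_pred g) i, true)
  end.

Fact chain_next_subproof (i : 'I_g.-1) : (i.+1 < g)%N.
Proof. by rewrite -ltn_predRL; exact: ltn_ord. Qed.

Definition chain_tgt (e : chain_edge) : chain_vertex :=
  match e with
  | inl (i, b) => (i, ~~ b)
  | inr i => (Ordinal (chain_next_subproof i), false)
  end.

Definition chain_len (e : chain_edge) : R :=
  match e with
  | inl (i, b) =>
      if b then cycle_len C i.+1 - arc_len C i.+1 else arc_len C i.+1
  | inr i => bridge_len C i.+1
  end.

Fact chain_len_gt0 (e : chain_edge) : 0 < chain_len e.
Proof.
case: e => [[i b]|i] /=; last by apply: bridge_len_gt0; exact: chain_next_subproof.
have iP : (1 <= i.+1 <= g)%N by exact: ltn_ord.
have gt0 := arc_len_gt0 C iP; case: b => //.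
exact: lt_le_trans gt0 (arc_len_shortest C iP).
Qed.

Definition chain_graph : metricGraph R :=
  @MetricGraph R chain_vertex chain_edge chain_src chain_tgt chain_len
    chain_len_gt0.

(* The torsion m_i of C_i, for 1 <= i <= g. *)
Definition torsion (i : nat) : nat :=
  if `[< irrational (cycle_len C i / arc_len C i) >] then 0%N
  else xget 0%N [set m : nat |
    let torsion_multiple (n : nat) :=
      (0 < n)%N /\ exists k : int, n%:R * arc_len C i = k%:~R * cycle_len C i in
    torsion_multiple m /\ forall n, torsion_multiple n -> (m <= n)%N].

(* [s] is the sequence j_1, ..., j_k. *)
Definition martens_special_of_type (r k : nat) : Prop :=
  (2 * r + 3 <= g)%N /\
  exists s : seq nat,
    [/\ size s = k,
        all (fun j => r + 1 < j < g - r)%N s,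
        sorted (fun j j' => j + (r + 1) <= j')%N s,
        (forall j, j \in s -> torsion j <> 2%N) &
        forall i, (2 <= i <= g - 1)%N -> i \notin s -> torsion i = 2%N].

Definition martens_special (r : nat) : Prop :=
  exists2 k, (1 <= k)%N & martens_special_of_type r k.

End ChainOfCycles.

(* Main.v *)
(** A divisor class on a chain of cycles is determined by its degree and, for each
   cycle [C_i], by the sum in the circle group [R / l_i Z] of the images of its
   points under the retraction of the chain onto [C_i] (Abel-Jacobi).  We show
   that [w^r_(g-2+r) >= g - r - 2 > w^1_(g-r)].

   For the first inequality, an effective divisor of degree [g - 2] is equivalent
   to a sum of one point on each cycle other than two cycles [p < q].  Being
   Martens-special provides a set [S] of [r + 2] cycles containing [p] and [q],
   in which only the first and the last cycle may have torsion other than 2.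
   Adding a suitable point on each cycle of [S] other than [p] and [q] gives a
   divisor that looks on [S] like [2r] chips leaving the first cycle of [S], and
   this has rank at least [r] since pairs of chips pass through the cycles of
   torsion 2.

   For the second inequality, take a cycle [C_j] of torsion other than 2 and put
   generic points on [g - r - 1] cycles other than [C_(j-1)], [C_j], [C_(j+1)].
   After adding any further point, at most two chips can be brought to [C_j] from
   its side; they cannot pass [C_j] together, so that a generic point of the
   neighbour of [C_j] on the other side is not reached. *)

From HB Require Import structures.
Require Import Defs.
From mathcomp Require Import zify ring lra.

Set Implicit Arguments.
Unset Strict Implicit.
Unset Printing Implicit Defensive.
Import Order.TTheory GRing.Theory Num.Theory.
Local Open Scope ring_scope.

(** * Piecewise affine functions *)

Section Kinked.
Variable R : realType.
Implicit Types (c x y l t : R) (a b : int) (ks : seq (int * R)).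

(** An entry [(b, y)] of [ks] raises the slope by [b] at [y]. This form is additive in [(c, a, ks)],
    lists being concatenated, so that adding functions needs no common subdivision. *)
Definition kinked c a ks t : R :=
  c + a%:~R * t + \sum_(k <- ks) k.1%:~R * Num.max 0 (t - k.2).

Definition right_slope a ks x : int := a + \sum_(k <- ks | k.2 <= x) k.1.
Definition left_slope a ks x : int := a + \sum_(k <- ks | k.2 < x) k.1.

Lemma kinked_affine c a ks x y t :
  (forall k, k \in ks -> k.2 <= x \/ y <= k.2) -> x <= t <= y ->
  kinked c a ks t = kinked c a ks x + (right_slope a ks x)%:~R * (t - x).
Proof.
move=> ksP /andP[xt ty]; rewrite /kinked /right_slope intrD mulrDl.
suff -> : \sum_(k <- ks) k.1%:~R * Num.max 0 (t - k.2) =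
    \sum_(k <- ks) k.1%:~R * Num.max 0 (x - k.2) +
    (\sum_(k <- ks | k.2 <= x) k.1)%:~R * (t - x) by lra.
rewrite rmorph_sum /= mulr_suml [X in _ + X]big_mkcond -big_split /=.
rewrite big_seq [RHS]big_seq; apply: eq_bigr => -[b z] /= /ksP /= zP.
case: ifPn => zx; first by rewrite !max_r ?subr_ge0 //; [lra | lra].
have yz : y <= z by case: zP => // zx'; rewrite zx' in zx.
by rewrite !max_l; lra.
Qed.

(** Pieces are absorbed from left to right. All earlier kinks lie at or before [x i], so the
    expression built so far continues affinely and one new kink at [x i] corrects its slope. *)
Lemma pw_affine_kinked l h : pw_affine_int l h ->
  exists c a ks, forall t, 0 <= t <= l -> h t = kinked c a ks t.
Proof.
case=> n [x [a [x0 xn step]]].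
suff [c [b [ks [_ kP]]]] : exists c b ks,
    (forall k, k \in ks -> k.2 <= x n) /\
    forall t, 0 <= t <= x n -> h t = kinked c b ks t.
  by exists c, b, ks => t; rewrite -xn; exact: kP.
have x_ge0 i : (i <= n)%N -> 0 <= x i.
  elim: i => [|i IHi] lin; first by rewrite x0.
  have [? _] := step i lin.
  by have := IHi (ltnW lin); lra.
have: (n <= n)%N by [].
elim: {1 3 4}n => [|i IHi] lin.
  exists (h 0), 0, [::]; split=> // t; rewrite x0 => tP.
  have -> : t = 0 by lra.
  by rewrite /kinked big_nil; lra.
have [c [b [ks [ksP kP]]]] := IHi (ltnW lin).
have [xi hP] := step i lin.
have xi0 := x_ge0 i (ltnW lin).
pose s := right_slope b ks (x i).
exists c, b, ((a i - s, x i) :: ks); split.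
  move=> k; rewrite inE => /predU1P[-> /=|/ksP]; lra.
move=> t /andP[t0 tx].
have -> : kinked c b ((a i - s, x i) :: ks) t =
    kinked c b ks t + (a i - s)%:~R * Num.max 0 (t - x i).
  by rewrite /kinked big_cons /=; lra.
have [tle|tgt] := leP t (x i).
  by rewrite max_l ?kP ?t0 //; lra.
rewrite max_r; last lra.
rewrite (@kinked_affine _ _ _ (x i) t); first last.
- lra.
- by move=> k /ksP; left.
rewrite hP; last lra.
rewrite -/s kP; last lra.
by rewrite intrB; lra.
Qed.

(** The break points are the two ends and the kinks strictly between them; a kink elsewhere does not
    break affinity on [0, l]. *)
Lemma kinked_pw_affine l h c a ks : 0 < l ->
  (forall t, 0 <= t <= l -> h t = kinked c a ks t) -> pw_affine_int l h.
Proof.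
move=> l0 hP.
pose ys := [:: 0, l & [seq k.2 | k <- ks & 0 < k.2 < l]].
pose xs := sort <=%R (undup ys).
have xs_mem y : (y \in xs) = (y \in ys) by rewrite mem_sort mem_undup.
have xs_sorted : sorted <%R xs by rewrite sort_lt_sorted undup_uniq.
have xs_bnd y : y \in xs -> 0 <= y <= l.
  rewrite xs_mem !inE => /or3P[/eqP->|/eqP->|]; [lra|lra|].
  by case/mapP => k; rewrite mem_filter => /andP[? _] ->; lra.
have size_gt0 : (0 < size xs)%N 
  by rewrite lt0n size_eq0; apply/eqP => xs0; have := xs_mem 0; rewrite xs0 !inE eqxx.
have nth_le i j : (i <= j)%N -> (j < size xs)%N -> xs`_i <= xs`_j.
  move=> ij js; rewrite le_eqVlt; move: ij; rewrite leq_eqVlt => /predU1P[->|ij].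
    by rewrite eqxx.
  by rewrite (sorted_ltn_nth lt_trans) ?orbT // inE (ltn_trans ij).
exists (size xs).-1, (nth 0 xs), (fun i => right_slope a ks xs`_i).
have xs0 : xs`_0 = 0.
  apply/eqP; rewrite eq_le.
  have /xs_bnd/andP[-> _] : xs`_0 \in xs by rewrite mem_nth.
  have /(nthP 0)[j js xj] : 0 \in xs by rewrite xs_mem inE eqxx.
  by rewrite /= -[leRHS]xj nth_le.
have lastlt : ((size xs).-1 < size xs)%N by rewrite prednK.
split=> //.
  apply/eqP; rewrite eq_le.
  have /xs_bnd/andP[_ ->] : xs`_(size xs).-1 \in xs by rewrite mem_nth.
  have /(nthP 0)[j js xj] : l \in xs by rewrite xs_mem !inE eqxx orbT.
  by rewrite -[leLHS]xj nth_le // -ltnS prednK.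
move=> i ilt; have iS : (i.+1 < size xs)%N by lia.
split.
  by apply: (sorted_ltn_nth lt_trans 0 xs_sorted) => //; rewrite inE // (ltn_trans _ iS).
have /xs_bnd/andP[xi0 xil] : xs`_i \in xs by rewrite mem_nth // ltnW.
have /xs_bnd/andP[xj0 xjl] : xs`_i.+1 \in xs by rewrite mem_nth.
move=> t tP; rewrite !hP; [|lra|lra].
apply: (@kinked_affine _ _ _ _ xs`_i.+1) => // k kks.
have [k0|k0] := leP k.2 0; first by left; lra.
have [k1|k1] := leP l k.2; first by right; lra.
have /(nthP 0)[j js <-] : k.2 \in xs.
  by rewrite xs_mem !inE map_f ?orbT // mem_filter kks k0 k1.
by case: (leqP j i) => ji; [left|right]; apply: nth_le => //; exact: ltnW.
Qed.

Local Open Scope classical_set_scope.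

Lemma kinked_right_slope c a ks x : \forall t \near 0^'+,
  kinked c a ks (x + t) - kinked c a ks x = (right_slope a ks x)%:~R * t.
Proof.
rewrite /kinked /right_slope; elim: ks => [|[b y] ks IH].
  by near=> t; rewrite !big_nil; lra.
have: \forall t \near 0^'+, Num.max 0 (x + t - y) - Num.max 0 (x - y)
    = (y <= x)%R%:R * t.
  have [yx|xy] := leP y x.
    near=> t; have t0 : 0 < t by near: t; exact: nbhs_right_gt.
    by rewrite !max_r ?mul1r; lra.
  have xy0 : 0 < y - x by lra.
  near=> t; have t0 : t < y - x by near: t; exact: nbhs_right_lt.
  by rewrite !max_l ?mul0r; lra.
move: IH; apply: filterS2 => t IH xt; rewrite !big_cons /=.
move: IH xt; set S1 := \sum_(k <- _) _; set S2 := \sum_(k <- _) _.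
move: S1 S2 => S1 S2 IH xt.
have -> : (b%:~R : R) * Num.max 0 (x + t - y) =
  b%:~R * Num.max 0 (x - y) + b%:~R * ((y <= x)%R%:R * t) by rewrite -xt; lra.
by move: IH; case: (y <= x)%R; rewrite !rmorphD /=; lra.
Unshelve. all: by end_near.
Qed.

Lemma kinked_left_slope c a ks x : \forall t \near 0^'+,
  kinked c a ks (x - t) - kinked c a ks x = - (left_slope a ks x)%:~R * t.
Proof.
rewrite /kinked /left_slope; elim: ks => [|[b y] ks IH].
  by near=> t; rewrite !big_nil; lra.
have: \forall t \near 0^'+, Num.max 0 (x - t - y) - Num.max 0 (x - y)
    = - (y < x)%R%:R * t.
  have [yx|xy] := ltP y x.
    have yx0 : 0 < x - y by lra.
    near=> t; have t0 : t < x - y by near: t; exact: nbhs_right_lt.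
    by rewrite !max_r ?mulN1r; lra.
  near=> t; have t0 : 0 < t by near: t; exact: nbhs_right_gt.
  by rewrite !max_l ?oppr0 ?mul0r; lra.
move: IH; apply: filterS2 => t IH xt; rewrite !big_cons /=.
move: IH xt; set S1 := \sum_(k <- _) _; set S2 := \sum_(k <- _) _.
move: S1 S2 => S1 S2 IH xt.
have -> : (b%:~R : R) * Num.max 0 (x - t - y) =
  b%:~R * Num.max 0 (x - y) + b%:~R * (- (y < x)%R%:R * t) by rewrite -xt; lra.
by move: IH; case: (y < x)%R; rewrite !rmorphD /=; lra.
Unshelve. all: by end_near.
Qed.

End Kinked.

(** * Principal divisors *)

Section Principal.
Variables (R : realType) (G : metricGraph R).
Implicit Types (e : edge G) (v : vertex G) (x y t : R) (f : point G -> R).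

Lemma val_epoint e x : val (epoint e x) =
  if x <= 0 then inl (esrc e) else if x < elen e then inr (e, x) else inl (etgt e).
Proof.
rewrite /epoint; case: (leP x 0) => // x0; rewrite val_insubd /= x0 /=.
by case: ifP.
Qed.

Lemma epoint_le0 e x : x <= 0 -> epoint e x = vpoint (esrc e).
Proof. by move=> x0; rewrite /epoint x0. Qed.

Lemma epoint_ge e x : elen e <= x -> epoint e x = vpoint (etgt e).
Proof.
move=> xl; apply/val_inj; rewrite val_epoint /= leNgt.
by rewrite (lt_le_trans (elen_gt0 e) xl) /= ltNge xl.
Qed.

Lemma epoint_eq_vpoint e x v : (epoint e x == vpoint v) =
  (x <= 0) && (esrc e == v) || (elen e <= x) && (etgt e == v).
Proof.
rewrite -val_eqE val_epoint /=; have [x0|x0] := leP x 0.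
  by rewrite leNgt (le_lt_trans x0 (elen_gt0 e)) orbF.
by case: ltP.
Qed.

Lemma epoint_eq_interior e e' x y : 0 < y < elen e' ->
  (val (epoint e x) == inr (e', y)) = (e == e') && (x == y).
Proof.
move=> /andP[y0 yl]; rewrite val_epoint; have [x0|x0] := leP x 0.
  by apply/esym/negbTE/negP => /andP[_ /eqP xy]; lra.
have [xl|xl] := ltP; first by [].
by apply/esym/negbTE/negP => /andP[/eqP ee' /eqP xy]; move: yl xl; rewrite ee' xy; lra.
Qed.

(* Kinks outside [0, elen e] are allowed: [epoint] is constant there, so that
   they contribute the right amount at the two ends. *)
Definition edge_div e (a : int) (ks : seq (int * R)) : divisor G :=
  << a *g vpoint (esrc e) >> + \sum_(k <- ks) << k.1 *g epoint e k.2 >>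
    - << (a + \sum_(k <- ks) k.1) *g vpoint (etgt e) >>.

Lemma coeff_edge_div e a ks p : coeff p (edge_div e a ks) =
  a * (vpoint (esrc e) == p)%:R +
  \sum_(k <- ks) k.1 * (epoint e k.2 == p)%:R
    - (a + \sum_(k <- ks) k.1) * (vpoint (etgt e) == p)%:R.
Proof.
rewrite /edge_div coeffB coeffD !coeffU raddf_sum /=; congr (_ + _ - _).
by apply: eq_bigr => k _; rewrite coeffU.
Qed.

(** [epoint] sends the kinks at or before 0 to the source, where they join [a] to form the right
    slope, and those at or after [elen e] to the target, where they cut the total slope down to the
    left slope. *)
Lemma coeff_vertex_edge_div e a ks v :
  coeff (vpoint v) (edge_div e a ks) =
    right_slope a ks 0 * (esrc e == v)%:R - left_slope a ks (elen e) * (etgt e == v)%:R.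
Proof.
rewrite coeff_edge_div /right_slope /left_slope.
have vpE w : (vpoint w == vpoint v) = (w == v) by rewrite -val_eqE.
rewrite !vpE.
have -> : \sum_(k <- ks) k.1 * (epoint e k.2 == vpoint v)%:R =
    (\sum_(k <- ks | k.2 <= 0) k.1) * (esrc e == v)%:R +
    (\sum_(k <- ks | elen e <= k.2) k.1) * (etgt e == v)%:R.
  rewrite !mulr_suml [X in _ = X + _]big_mkcond [X in _ = _ + X]big_mkcond -big_split /=.
  apply: eq_bigr => -[b y] _ /=; rewrite epoint_eq_vpoint.
  have [y0|y0] := leP y 0; last by case: leP => _ /=; rewrite ?mulr0 ?addr0 ?add0r.
  by rewrite leNgt (le_lt_trans y0 (elen_gt0 e)) /= orbF addr0.
have -> : \sum_(k <- ks) k.1 =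
    \sum_(k <- ks | k.2 < elen e) k.1 + \sum_(k <- ks | elen e <= k.2) k.1.
  rewrite (bigID (fun k => k.2 < elen e)) /=; congr (_ + _).
  by apply: eq_bigl => k; rewrite leNgt.
by ring.
Qed.

Lemma coeff_interior_edge_div e e' a ks p x : val p = inr (e', x) ->
  coeff p (edge_div e a ks) = (right_slope a ks x - left_slope a ks x) * (e == e')%:R.
Proof.
move=> px; have := valP p; rewrite px /= => xP.
rewrite coeff_edge_div -!(inj_eq val_inj) px /= !mulr0 add0r subr0.
have -> : right_slope a ks x - left_slope a ks x = \sum_(k <- ks) k.1 * (k.2 == x)%:R.
  rewrite /right_slope /left_slope opprD addrACA subrr add0r.
  rewrite big_mkcond [X in _ - X]big_mkcond -sumrB; apply: eq_bigr => -[b y] _ /=.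
  by case: ltgtP => _; rewrite ?subrr ?subr0 ?mulr0 ?mulr1.
rewrite mulr_suml; apply: eq_bigr => k _; rewrite -mulrA -natrM mulnb.
by rewrite -val_eqE px epoint_eq_interior // andbC.
Qed.

Local Open Scope classical_set_scope.

Lemma outgoing_slopeE f (gamma : R -> point G) s :
  (\forall t \near 0^'+, f (gamma t) - f (gamma 0) = s * t) ->
  outgoing_slope f gamma = s.
Proof.
move=> fs; rewrite /outgoing_slope.
apply: cvg_lim => //; apply: cvg_near_cst.
have : \forall t \near (0:R)^'+, 0 < t by exact: nbhs_right_gt.
by move: fs; apply: filterS2 => t -> t0; rewrite mulfK // gt_eqF.
Qed.

Section KinkedFunction.
Variables (f : point G -> R) (c : edge G -> R) (a : edge G -> int)
  (ks : edge G -> seq (int * R)).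
Hypothesis fE : forall e t, 0 <= t <= elen e ->
  f (epoint e t) = kinked (c e) (a e) (ks e) t.

Lemma outgoing_slope_forward e x : 0 <= x < elen e ->
  outgoing_slope f (fun t => epoint e (x + t)) = (right_slope (a e) (ks e) x)%:~R.
Proof.
move=> /andP[x0 xl]; apply: outgoing_slopeE.
have xl0 : 0 < elen e - x by lra.
near=> t; have tl : t < elen e - x by near: t; exact: nbhs_right_lt.
have t0 : 0 < t by near: t; exact: nbhs_right_gt.
rewrite addr0 !fE; [|lra|lra].
by near: t; exact: kinked_right_slope.
Unshelve. all: by end_near.
Qed.

Lemma outgoing_slope_backward e x : 0 < x <= elen e ->
  outgoing_slope f (fun t => epoint e (x - t)) = - (left_slope (a e) (ks e) x)%:~R.
Proof.
move=> /andP[x0 xl]; apply: outgoing_slopeE.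
near=> t; have tl : t < x by near: t; exact: nbhs_right_lt.
have t0 : 0 < t by near: t; exact: nbhs_right_gt.
rewrite subr0 !fE; [|lra|lra].
by near: t; exact: kinked_left_slope.
Unshelve. all: by end_near.
Qed.

(** Links the limits in [order_at] to the algebraic [edge_div]: on both sides an edge contributes
    its right slope where it leaves [p] and minus its left slope where it arrives. *)
Lemma order_at_kinked p :
  order_at f p = (coeff p (\sum_e edge_div e (a e) (ks e)))%:~R.
Proof.
rewrite raddf_sum /= rmorph_sum /= /order_at /tangents.
case pE: (val p) => [v|[e0 x]].
  have -> : p = vpoint v by apply/val_inj.
  rewrite big_cat !big_map !big_filter !big_enum_cond /=.
  under [RHS]eq_bigr do rewrite coeff_vertex_edge_div rmorphB /= !rmorphM /= !rmorph_nat.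
  rewrite sumrB; congr (_ + _).
    rewrite big_mkcond; apply: eq_bigr => e _ /=.
    case: eqP => _; rewrite ?mulr0 ?mulr1 //.
    rewrite -outgoing_slope_forward ?lexx ?elen_gt0 //.
    by congr outgoing_slope; apply/boolp.funext => t; rewrite add0r.
  rewrite -sumrN big_mkcond; apply: eq_bigr => e _ /=.
  case: eqP => _; rewrite ?mulr0 ?oppr0 ?mulr1 //.
  by rewrite outgoing_slope_backward ?lexx ?elen_gt0.
have := valP p; rewrite pE /= => /andP[x0 xl].
rewrite big_cons big_seq1 outgoing_slope_forward ?xl ?ltW //.
rewrite outgoing_slope_backward ?x0 ?ltW // (bigD1 e0) //=.
rewrite (coeff_interior_edge_div _ _ _ pE) eqxx mulr1 rmorphB big1 ?addr0 // => e ee0.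
by rewrite (coeff_interior_edge_div _ _ _ pE) (negPf ee0) mulr0.
Qed.

Lemma kinked_rational : rational_function f.
Proof.
by move=> e; apply: (@kinked_pw_affine _ _ _ (c e) (a e) (ks e) (elen_gt0 e)) => t; exact: fE.
Qed.

End KinkedFunction.

(** A limit-free form of linear equivalence to 0. The single function [f] forces the expressions on
    different edges to agree at common vertices. *)
Definition principal (D : divisor G) : Prop := exists f c a ks,
  (forall e t, 0 <= t <= elen e -> f (epoint e t) = kinked (c e) (a e) (ks e) t) /\
  D = \sum_e edge_div e (a e) (ks e).

Lemma lin_equivE (D D' : divisor G) : lin_equiv D D' <-> principal (D' - D).
Proof.
split.
  case=> f frat ford.
  have /boolp.choice[c /boolp.choice[a /boolp.choice[ks fE]]] : forall e, exists c a ks,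
      forall t, 0 <= t <= elen e -> f (epoint e t) = kinked c a ks t.
    by move=> e; exact: pw_affine_kinked (frat e).
  exists f, c, a, ks; split=> //; apply/eqP/freeg_eqP => p.
  apply: (@intr_inj R); rewrite ford; exact: (order_at_kinked fE).
case=> f [c [a [ks [fE DE]]]]; exists f; first exact: kinked_rational fE.
by move=> p; rewrite (order_at_kinked fE) -DE.
Qed.

Lemma principal0 : principal 0.
Proof.
exists (fun=> 0), (fun=> 0), (fun=> 0), (fun=> [::]); split.
  by move=> e t _; rewrite /kinked big_nil; lra.
rewrite big1 // => e _; rewrite /edge_div !big_nil !addr0 !freegU0 subrr.
by [].
Qed.

Lemma principalD D D' : principal D -> principal D' -> principal (D + D').
Proof.
case=> f [c [a [ks [fE ->]]]] [f' [c' [a' [ks' [fE' ->]]]]].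
exists (fun p => f p + f' p), (fun e => c e + c' e), (fun e => a e + a' e),
  (fun e => ks e ++ ks' e); split.
  by move=> e t tP; rewrite fE // fE' // /kinked big_cat /= rmorphD /=; lra.
rewrite -big_split; apply: eq_bigr => e _; apply/eqP/freeg_eqP => p.
by rewrite /= coeffD !coeff_edge_div !big_cat /=; ring.
Qed.

Lemma principalN D : principal D -> principal (- D).
Proof.
case=> f [c [a [ks [fE ->]]]].
exists (fun p => - f p), (fun e => - c e), (fun e => - a e),
  (fun e => [seq (- k.1, k.2) | k <- ks e]); split.
  move=> e t tP; rewrite fE // /kinked big_map /= rmorphN /=.
  under [X in _ = _ + X]eq_bigr do rewrite rmorphN mulNr.
  by rewrite sumrN; lra.
rewrite -sumrN; apply: eq_bigr => e _; apply/eqP/freeg_eqP => p.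
rewrite coeffN !coeff_edge_div !big_map /= sumrN.
under [X in _ = _ + X - _]eq_bigr do rewrite mulNr.
by rewrite sumrN; ring.
Qed.

Lemma principalB D D' : principal D -> principal D' -> principal (D - D').
Proof. by move=> ? /principalN; exact: principalD. Qed.

Lemma principal_sum (I : Type) (r : seq I) (F : I -> divisor G) :
  (forall i, principal (F i)) -> principal (\sum_(i <- r) F i).
Proof. by move=> ?; apply: big_ind => //; [exact: principal0 | exact: principalD]. Qed.

End Principal.

(** * Congruence of real numbers modulo the length of a circle *)

Section Congruence.
Variables (R : realType) (l : R).
Implicit Types x y z : R.

Definition eqmodr x y : Prop := exists k : int, x - y = k%:~R * l.

Lemma eqmodr_refl x : eqmodr x x.
Proof. by exists 0; rewrite subrr mul0r. Qed.

Lemma eqmodr_sym x y : eqmodr x y -> eqmodr y x.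
Proof. by case=> k xy; exists (- k); rewrite rmorphN mulNr -xy opprB. Qed.

Lemma eqmodr_trans y x z : eqmodr x y -> eqmodr y z -> eqmodr x z.
Proof. by move=> [k xy] [m yz]; exists (k + m); rewrite rmorphD mulrDl /= -xy -yz; lra. Qed.

Lemma eqmodrD x y x' y' : eqmodr x y -> eqmodr x' y' -> eqmodr (x + x') (y + y').
Proof. by move=> [k xy] [m yz]; exists (k + m); rewrite rmorphD mulrDl /= -xy -yz; lra. Qed.

Lemma eqmodrN x y : eqmodr x y -> eqmodr (- x) (- y).
Proof. by case=> k xy; exists (- k); rewrite rmorphN mulNr -xy; lra. Qed.

Lemma eqmodrB x y x' y' : eqmodr x y -> eqmodr x' y' -> eqmodr (x - x') (y - y').
Proof. by move=> xy /eqmodrN; exact: eqmodrD. Qed.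

Lemma eqmodrMz (b : int) x y : eqmodr x y -> eqmodr (b%:~R * x) (b%:~R * y).
Proof. by case=> k xy; exists (b * k); rewrite rmorphM -mulrA -xy /= mulrBr. Qed.

Lemma eqmodr_sum (I : Type) (r : seq I) (F F' : I -> R) :
  (forall i, eqmodr (F i) (F' i)) -> eqmodr (\sum_(i <- r) F i) (\sum_(i <- r) F' i).
Proof.
by move=> FF'; apply: big_rec2 => [|i x y _]; [exact: eqmodr_refl | exact: eqmodrD].
Qed.

Hypothesis l_gt0 : 0 < l.

Lemma eqmodr_eq x y : 0 <= x < l -> 0 <= y < l -> eqmodr x y -> x = y.
Proof.
move=> /andP[x0 xl] /andP[y0 yl] [k xy].
have klt (b : int) : b%:~R * l < l -> b < 1.
  by rewrite -[X in _ < X]mul1r ltr_pM2r // (ltr_int R b 1).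
have k1 : k < 1 by apply: klt; lra.
have k2 : - k < 1 by apply: klt; rewrite rmorphN mulNr; lra.
have k0 : k = 0 by lia.
by rewrite k0 mul0r in xy; lra.
Qed.

Definition redmod x : R := x - (Num.floor (x / l))%:~R * l.

Lemma redmod_itv x : 0 <= redmod x < l.
Proof.
rewrite /redmod subr_ge0 -ler_pdivlMr // floor_le //=.
rewrite ltrBlDr -[X in X + _]mul1r -mulrDl -ltr_pdivrMr // addrC.
by have := floorD1_gt (x / l); rewrite rmorphD.
Qed.

Lemma redmod_eqmodr x : eqmodr (redmod x) x.
Proof. by exists (- Num.floor (x / l)); rewrite /redmod rmorphN; lra. Qed.

Lemma redmod_eq x y : eqmodr x y -> redmod x = redmod y.
Proof.
move=> xy; apply: eqmodr_eq; rewrite ?redmod_itv //.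
apply: eqmodr_trans (redmod_eqmodr _) _.
by apply: eqmodr_trans xy _; apply: eqmodr_sym; exact: redmod_eqmodr.
Qed.

Lemma redmod_id x : 0 <= x < l -> redmod x = x.
Proof. by move=> xP; apply: eqmodr_eq; rewrite ?redmod_itv //; exact: redmod_eqmodr. Qed.

End Congruence.

(** * Additive extension of functions to divisors *)

Section Evaluation.
Variables (R : realType) (G : metricGraph R).
Implicit Types (phi : point G -> R) (D : divisor G).

Definition dval phi D : R := fglift (phi : point G -> zmodule R) D.

Lemma dval_is_additive phi : additive (dval phi).
Proof. exact: (@lift_is_additive int (point G) (zmodule R) phi). Qed.

HB.instance Definition _ phi :=
  GRing.isAdditive.Build (divisor G) R (dval phi) (dval_is_additive phi).

Lemma dvalU phi k x : dval phi << k *g x >> = k%:~R * phi x.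
Proof. by rewrite /dval liftU scalezrE mulrzl. Qed.

Lemma deg_edge_div (e : edge G) a ks : deg (edge_div e a ks) = 0.
Proof.
rewrite /edge_div degB degD !degU raddf_sum /=.
under eq_bigr do rewrite degU.
by rewrite subrr.
Qed.

Lemma principal_deg D : principal D -> deg D = 0.
Proof.
case=> f [c [a [ks [_ ->]]]]; rewrite raddf_sum big1 // => e _; exact: deg_edge_div.
Qed.

(** Summation by parts along one edge: [phi] being affine there, its value on the divisor is [beta]
    times the weighted sum of the kink positions, which is the increment of the function up to
    sign. *)
Lemma dval_edge_div phi (e : edge G) a ks c l alpha beta :
  (forall t, 0 <= t <= elen e -> eqmodr l (phi (epoint e t)) (alpha + beta * t)) ->
  eqmodr l (dval phi (edge_div e a ks))
    (- beta * (kinked c a ks (elen e) - kinked c a ks 0)).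
Proof.
move=> phiP; have L0 := elen_gt0 e.
(* [epoint e] is constant beyond either end, so positions may be clamped to the range where [phi] is
   known to be affine. *)
pose clamp y := Num.max 0 (Num.min y (elen e)).
have clampP y : 0 <= clamp y <= elen e.
  by rewrite le_max lexx ge_max ge_min lexx orbT /= ltW.
have epoint_clamp y : epoint e y = epoint e (clamp y).
  rewrite /clamp; case: (leP y (elen e)) => yL.
    by case: (leP y 0) => y0 //; rewrite !epoint_le0.
  by rewrite max_r ?(ltW L0) // !epoint_ge // ltW.
have -> : - beta * (kinked c a ks (elen e) - kinked c a ks 0) =
    a%:~R * (alpha + beta * 0) + \sum_(k <- ks) k.1%:~R * (alpha + beta * clamp k.2)
    - (a + \sum_(k <- ks) k.1)%:~R * (alpha + beta * elen e).
  rewrite /kinked rmorphD rmorph_sum /=.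
  have -> : \sum_(k <- ks) k.1%:~R * (alpha + beta * clamp k.2) =
      (\sum_(k <- ks) k.1%:~R) * (alpha + beta * elen e)
      - beta * (\sum_(k <- ks) k.1%:~R * Num.max 0 (elen e - k.2)
        - \sum_(k <- ks) k.1%:~R * Num.max 0 (0 - k.2)).
    rewrite -sumrB mulr_suml mulr_sumr -sumrB; apply: eq_bigr => -[b y] _ /=.
    (* The hinges of the kink evaluated at the two ends of the edge recover its clamped position. *)
    have -> : clamp y = elen e - Num.max 0 (elen e - y) + Num.max 0 (0 - y).
      rewrite /clamp; case: (leP y (elen e)) => yL.
        rewrite [Num.max 0 (elen e - y)]max_r; last lra.
        by case: (leP 0 y) => y0; [rewrite max_l | rewrite max_r]; lra.
      rewrite [Num.max 0 (elen e)]max_r; last lra.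
      by rewrite !max_l; lra.
    by ring.
  by ring.
rewrite /edge_div raddfB raddfD raddf_sum /= !dvalU.
under eq_bigr do rewrite dvalU epoint_clamp.
apply: eqmodrB; last first.
  by apply: eqmodrMz; rewrite -(@epoint_ge _ _ _ (elen e)) //; apply: phiP; lra.
apply: eqmodrD.
  by apply: eqmodrMz; rewrite -(@epoint_le0 _ _ _ 0) //; apply: phiP; lra.
by apply: eqmodr_sum => k; apply: eqmodrMz; exact: phiP.
Qed.

End Evaluation.

(** * The Abel-Jacobi theorem for chains of cycles *)

Section Retractions.
Variables (R : realType) (g : nat) (C : chain_of_cycles R g).
Local Notation Gam := (chain_graph C).
Implicit Types (i j : 'I_g) (x : point Gam) (t : R).

Definition clen i : R := cycle_len C i.+1.
Definition carc i : R := arc_len C i.+1.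

Lemma ord_range i : (1 <= i.+1 <= g)%N.
Proof. exact: ltn_ord. Qed.

Lemma carc_gt0 i : 0 < carc i.
Proof. exact: arc_len_gt0 (ord_range i). Qed.

Lemma carc_le i : carc i <= clen i - carc i.
Proof. exact: arc_len_shortest (ord_range i). Qed.

Lemma clen_gt0 i : 0 < clen i.
Proof. by have := carc_gt0 i; have := carc_le i; lra. Qed.

Definition left_cycle (b : 'I_g.-1) : 'I_g := widen_ord (leq_pred g) b.

Definition vpt i : point Gam := @vpoint R Gam (i, false).
Definition wpt i : point Gam := @vpoint R Gam (i, true).

(* The bridge leaving [w_i] is attached to the cycle [i]. *)
Definition cyc x : 'I_g :=
  match val x with
  | inl (i, _) => i
  | inr (inl (i, _), _) => i
  | inr (inr b, _) => left_cycle b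
  end.

Definition on_bridge x : bool :=
  match val x with
  | inr (inr _, _) => true
  | _ => false
  end.

Definition ppos x : R :=
  match val x with
  | inl (i, b) => if b then carc i else 0
  | inr (inl (i, b), t) => if b then carc i + t else t
  | inr (inr b, _) => carc (left_cycle b)
  end.

(* The coordinate on the circle [R / clen i] of the image of [x] under the
   retraction of the chain onto its cycle [i]. *)
Definition pos i x : R :=
  if (i < cyc x)%N then carc i else if i == cyc x then ppos x else 0.

Lemma pos_lt i x : (i < cyc x)%N -> pos i x = carc i.
Proof. by rewrite /pos => ->. Qed.

Lemma pos_gt i x : (cyc x < i)%N -> pos i x = 0.
Proof. by move=> xi; rewrite /pos ltnNge (ltnW xi) -val_eqE /= gtn_eqF. Qed.

Lemma pos_eq x : pos (cyc x) x = ppos x.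
Proof. by rewrite /pos ltnn eqxx. Qed.

Lemma ppos_itv x : 0 <= ppos x < clen (cyc x).
Proof.
rewrite /ppos /cyc; have := valP x.
case: (val x) => [[i [] _]|[[[i []]|b] t]] /=; rewrite -/(carc _) -/(clen _).
- by have := carc_gt0 i; have := carc_le i; lra.
- by have := clen_gt0 i; lra.
- by have := carc_gt0 i; lra.
- by have := carc_gt0 i; have := carc_le i; lra.
- by have := carc_gt0 (left_cycle b); have := carc_le (left_cycle b); lra.
Qed.

Definition edge_start i (e : edge Gam) : R :=
  match e with
  | inl (j, b) => if (i < j)%N then carc i else if i == j then (if b then carc i else 0) else 0
  | inr b => if (i <= b)%N then carc i else 0
  end.

Definition edge_speed i (e : edge Gam) : int :=
  match e with
  | inl (j, _) => (i == j)%:R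
  | inr _ => 0
  end.

(** The second alternative is the end of the complementary arc, at the vertex [(i, false)], where
    the affine formula reaches [clen i] while the coordinate restarts at 0. *)
Lemma pos_epoint i (e : edge Gam) t : 0 <= t <= elen e ->
  pos i (epoint e t) = edge_start i e + (edge_speed i e)%:~R * t
  \/ edge_start i e + (edge_speed i e)%:~R * t = clen i /\ pos i (epoint e t) = 0.
Proof.
move=> /andP[t0 tL].
have bridgeE (b : 'I_g.-1) : (if (i < left_cycle b)%N then carc i
    else if i == left_cycle b then carc (left_cycle b) else 0) = if (i <= b)%N then carc i else 0.
  by have [->|] := eqVneq i (left_cycle b); rewrite ?ltnn ?leqnn // -val_eqE ltn_neqAle /= => ->.
rewrite /pos /cyc /ppos val_epoint.
case: (leP t 0) => t0'; [|case: (ltP t (elen e)) => tL'].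
- have -> : t = 0 by lra.
  case: e tL => [[j b]|b] _ /=; left; rewrite mulr0 addr0; last exact: bridgeE.
  by have [->|_] := eqVneq i j.
- case: e tL tL' => [[j b]|b] _ tL' /=; left; last by rewrite mul0r addr0 bridgeE.
  have [->|_] := eqVneq i j; last by rewrite mul0r addr0.
  by rewrite ltnn mul1r; case: b {tL'}; rewrite ?add0r.
- have {tL tL'}: t = elen e by lra.
  case: e => [[j b]|b] /= ->; last first.
    left; rewrite mul0r addr0 ltnS; case: leqP => // h.
    by case: ifP.
  have [->|_] := eqVneq i j; last by left; rewrite mul0r addr0.
  rewrite ltnn mul1r; case: b => /=; last by left; rewrite add0r.
  by right; split=> //; rewrite /clen /carc; lra.
Qed.

End Retractions.

(** * Divisor classes and their coordinates on the cycles *)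

Section AbelJacobi.
Variables (R : realType) (g : nat) (C : chain_of_cycles R g).
Local Notation Gam := (chain_graph C).
Implicit Types (i j : 'I_g) (x : point Gam) (t : R) (D : divisor Gam).

Local Notation aj i := (dval (@pos R g C i)).

Lemma sum_edges (V : nmodType) (F : edge Gam -> V) : \sum_e F e =
  \sum_j (F (inl (j, true)) + F (inl (j, false))) + \sum_(b < g.-1) F (inr b).
Proof.
rewrite big_sumType /=; congr (_ + _).
rewrite [RHS](eq_bigr (fun j => \sum_b F (inl (j, b)))); last by move=> j _; rewrite big_bool.
by rewrite pair_bigA; apply: eq_bigr => -[].
Qed.

Lemma pos_epoint_eqmodr i (e : edge Gam) t : 0 <= t <= elen e ->
  eqmodr (clen C i) (pos i (epoint e t)) (edge_start i e + (edge_speed i e)%:~R * t).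
Proof.
move=> /(pos_epoint i)[->|[-> ->]]; first exact: eqmodr_refl.
by exists (-1); lra.
Qed.

(** By [dval_edge_div] only the two arcs of cycle [i] count, and the increments of [f] along them
    cancel since they form a closed loop. *)
Lemma principal_aj D i : principal D -> eqmodr (clen C i) (aj i D) 0.
Proof.
case=> f [c [a [ks [fE ->]]]]; rewrite raddf_sum /=.
have L0 (e : edge Gam) := elen_gt0 e.
pose df (e : edge Gam) := f (epoint e (elen e)) - f (epoint e 0).
have df0 : \sum_(e : edge Gam) - (edge_speed i e)%:~R * df e = 0.
  rewrite sum_edges [X in _ + X]big1 ?addr0; last by move=> b _; rewrite oppr0 mul0r.
  rewrite big1 // => j _; rewrite /= /df -mulrDr.
  rewrite !(epoint_le0 _ (lexx 0)) !(epoint_ge (lexx _)) /=.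
  by rewrite addrC subrKA subrr mulr0.
rewrite -[X in eqmodr _ _ X]df0; apply: eqmodr_sum => e; rewrite /df !fE; [|by rewrite lexx ltW..].
by apply: dval_edge_div => t; exact: pos_epoint_eqmodr.
Qed.

Definition circle_pt i t : point Gam :=
  if t <= carc C i then @epoint R Gam (inl (i, false)) t
  else @epoint R Gam (inl (i, true)) (t - carc C i).

Lemma cyc_circle_pt i t : cyc (circle_pt i t) = i.
Proof. by rewrite /circle_pt /cyc; case: ifP => _; rewrite val_epoint /=; do 2?case: ifP. Qed.

Lemma ppos_circle_pt i t : 0 <= t < clen C i -> ppos (circle_pt i t) = t.
Proof.
move=> /andP[t0 tl]; rewrite /circle_pt /ppos; case: (leP t (carc C i)) => ta;
  rewrite val_epoint /= -/(carc C i) -/(clen C i).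
  by case: (leP t 0) => t0'; [lra|case: ltP => ta' //; lra].
by case: (leP (t - _) 0) => ta'; [lra|case: ltP => tl' /=; lra].
Qed.

Lemma circle_pt_ppos x : ~~ on_bridge x -> circle_pt (cyc x) (ppos x) = x.
Proof.
rewrite /on_bridge => xb; apply/val_inj; move: xb (valP x).
rewrite /circle_pt /cyc /ppos; case: (val x) => [[i [] _ _]|[[[i []]|b] t]] //=.
- by rewrite lexx [LHS]val_epoint /= -/(carc C i) ltxx leNgt carc_gt0.
- by rewrite (ltW (carc_gt0 C i)) [LHS]val_epoint lexx.
- move=> _ /andP[t0 tl].
  have /negPf -> : ~~ (carc C i + t <= carc C i) by rewrite -ltNge; lra.
  by rewrite addrC addKr [LHS]val_epoint tl leNgt t0.
- by move=> _ /andP[t0 tl]; rewrite (ltW tl) [LHS]val_epoint /= tl leNgt t0.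
Qed.

Lemma circle_pt0 i : circle_pt i 0 = vpt C i.
Proof. by rewrite /circle_pt (ltW (carc_gt0 C i)) epoint_le0. Qed.

Definition cpt i t : point Gam := circle_pt i (redmod (clen C i) t).

Lemma cyc_cpt i t : cyc (cpt i t) = i.
Proof. exact: cyc_circle_pt. Qed.

Lemma ppos_cpt i t : ppos (cpt i t) = redmod (clen C i) t.
Proof. by rewrite ppos_circle_pt // redmod_itv // clen_gt0. Qed.

Lemma pos_cpt i t : eqmodr (clen C i) (pos i (cpt i t)) t.
Proof.
rewrite -[X in pos X _](cyc_cpt i t) pos_eq ppos_cpt; exact: redmod_eqmodr.
Qed.

Lemma cpt_eqmodr i t t' : eqmodr (clen C i) t t' -> cpt i t = cpt i t'.
Proof. by move=> tt'; rewrite /cpt (redmod_eq (clen_gt0 C i) tt'). Qed.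

Lemma cpt_itv i t : 0 <= t < clen C i -> cpt i t = circle_pt i t.
Proof. by move=> tP; rewrite /cpt redmod_id // clen_gt0. Qed.

Lemma cpt0 i : cpt i 0 = vpt C i.
Proof. by rewrite cpt_itv ?lexx ?clen_gt0 // circle_pt0. Qed.

Lemma edge_div0 (e : edge Gam) : edge_div e 0 [::] = 0.
Proof. by rewrite /edge_div !big_nil !addr0 !freegU0 subrr. Qed.

(** The function is pulled back along the retraction onto cycle [i]. It leaves the coordinate 0 with
    slope [a] and has kinks at [u], [s] and [t]; the hypothesis says that it closes up after one
    turn. *)
Lemma principal_circle i (a : int) s t u :
  0 <= s < clen C i -> 0 <= t < clen C i -> 0 <= u < clen C i ->
  s + t - u = (1 - a)%:~R * clen C i ->
  principal (<< circle_pt i u >> + << vpt C i >> - << circle_pt i s >> - << circle_pt i t >>).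
Proof.
move=> /andP[s0 sl] /andP[t0 tl] /andP[u0 ul] stu.
pose ks : seq (int * R) := [:: (1, u); (-1, s); (-1, t)].
(* Since [F 0 = F (clen C i)], the function [F o pos i] is rational. *)
pose F := kinked 0 a ks.
have F0 : F 0 = 0.
  by rewrite /F /kinked !big_cons big_nil /= !max_l; lra.
have Fl : F (clen C i) = 0.
  rewrite /F /kinked !big_cons big_nil /= !max_r; [|lra|lra|lra].
  by move: stu; rewrite rmorphB /=; lra.
have Fpos (e : edge Gam) y : 0 <= y <= elen e ->
    F (pos i (epoint e y)) = F (edge_start i e + (edge_speed i e)%:~R * y).
  by move=> /(pos_epoint i)[->//|[-> ->]]; rewrite F0 Fl.
exists (fun x => F (pos i x)),
  (fun e => if edge_speed i e == 1 then a%:~R * edge_start i e else F (edge_start i e)),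
  (fun e => a * edge_speed i e),
  (fun e => if edge_speed i e == 1 then [seq (k.1, k.2 - edge_start i e) | k <- ks] else [::]).
split.
  move=> e y yP; rewrite Fpos //; case: eqP => [->|es].
    rewrite mulr1 mul1r /F /kinked big_map /= add0r mulrDr; congr (_ + _).
    by apply: eq_bigr => k _; rewrite opprB addrA [y + _]addrC.
  have -> : edge_speed i e = 0.
    by move: es; case: e {yP} => [[j b]|b] //=; case: eqP.
  by rewrite mul0r mulr0 !addr0 /kinked big_nil mul0r !addr0.
rewrite sum_edges [X in _ = _ + X]big1 ?addr0; last by move=> b _; rewrite /= mulr0 edge_div0.
rewrite (bigD1 i) //= [X in _ = _ + X]big1 ?addr0; last first.
  by move=> j ji; rewrite eq_sym (negPf ji) mulr0 /= !edge_div0 addr0.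
rewrite eqxx ltnn eqxx mulr1 !subr0 /edge_div !big_cons !big_nil /=.
(* Every kink is listed on both arcs. One copy is the intended point; the other falls at or beyond
   an end of its arc and lands on the vertex [(i, true)]. *)
have pairE y : 0 <= y < clen C i ->
    << @epoint R Gam (inl (i, true)) (y - carc C i) >> + << @epoint R Gam (inl (i, false)) y >>
      = << circle_pt i y >> + << wpt C i >> :> divisor Gam.
  move=> yP; rewrite /circle_pt; case: leP => ya.
    by rewrite addrC (@epoint_le0 R Gam (inl (i, true))) // subr_le0.
  by congr (_ + _); rewrite epoint_ge //=; apply: ltW.
have -> : a + (1 + (-1 + (-1 + 0))) = a - 1 by lia.
have pairE' b y : 0 <= y < clen C i ->
    << b *g @epoint R Gam (inl (i, true)) (y - carc C i) >>
      + << b *g @epoint R Gam (inl (i, false)) y >>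
      = << b *g circle_pt i y >> + << b *g wpt C i >> :> divisor Gam.
  by move=> /pairE pE; apply/eqP/freeg_eqP => p; have /(congr1 (coeff p)) := pE;
    rewrite !coeffD !coeffU !mul1r -!mulrDr => ->.
apply/eqP/freeg_eqP => p.
have E y b (yP : 0 <= y < clen C i) := congr1 (coeff p) (pairE' b y yP).
have := E u 1; have := E s (-1); have := E t (-1).
rewrite u0 s0 t0 ul sl tl => /(_ isT) Et /(_ isT) Es /(_ isT) Eu.
move: Et Es Eu; rewrite !(coeffD, coeffN, coeffU) /= -/(vpt C i) -/(wpt C i) !coeff0.
do ?[move: ((@epoint R Gam (inl (i, true)) _ == p)%:R) => ?].
do ?[move: ((@epoint R Gam (inl (i, false)) _ == p)%:R) => ?].
do ?[move: ((circle_pt i _ == p)%:R) => ?].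
move: ((vpt C i == p)%:R) ((wpt C i == p)%:R) => ? ?.
clear; lia.
Qed.

(** Modulo principal divisors, [theta i] is a homomorphism of period [clen C i], by [thetaD] and
    [theta_eqmodr] below. *)
Definition theta i t : divisor Gam := << cpt i t >> - << vpt C i >>.

Lemma theta0 i : theta i 0 = 0.
Proof. by rewrite /theta cpt0 subrr. Qed.

Lemma theta_eqmodr i t t' : eqmodr (clen C i) t t' -> theta i t = theta i t'.
Proof. by rewrite /theta => /cpt_eqmodr ->. Qed.

Lemma thetaD i s t : principal (theta i (s + t) - theta i s - theta i t).
Proof.
have l0 := clen_gt0 C i.
have -> : theta i (s + t) - theta i s - theta i t =
    << cpt i (s + t) >> + << vpt C i >> - << cpt i s >> - << cpt i t >>.
  by apply/eqP/freeg_eqP => p; rewrite !(coeffD, coeffN); lia.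
have stu : eqmodr (clen C i) (redmod (clen C i) s + redmod (clen C i) t)
    (redmod (clen C i) (s + t)).
  apply: eqmodr_trans (eqmodrD (redmod_eqmodr _ s) (redmod_eqmodr _ t)) _.
  exact: eqmodr_sym (redmod_eqmodr _ _).
case: stu => k kE.
(* [k] is the number of full turns dropped when the sum of the reduced coordinates is itself
   reduced. *)
apply: (@principal_circle i (1 - k)); rewrite ?redmod_itv //.
by rewrite kE; congr (_%:~R * _); lia.
Qed.

(** The retraction of the chain onto the bridge [b], as a distance from its left end. *)
Definition bridge_pos (b : 'I_g.-1) x : R :=
  let l := bridge_len C b.+1 in
  match val x with
  | inl (i, _) => if (i <= b)%N then 0 else l
  | inr (inl (i, _), _) => if (i <= b)%N then 0 else l
  | inr (inr b', y) => if b' == b then y else if (b' < b)%N then 0 else l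
  end.

(** The function grows with slope 1 along the bridge up to distance [t] and is constant elsewhere.
    Hence all points of a bridge are equivalent. *)
Lemma principal_bridge (b : 'I_g.-1) t :
  0 <= t <= @elen R Gam (inr b) ->
  principal (<< wpt C (left_cycle b) >> - << @epoint R Gam (inr b) t >>).
Proof.
move=> /andP[t0 tl].
have l0 := @elen_gt0 R Gam (inr b).
exists (fun x => Num.min (bridge_pos b x) t),
  (fun e : edge Gam => Num.min (bridge_pos b (epoint e 0)) t),
  (fun e : edge Gam => (e == inr b)%:R),
  (fun e : edge Gam => if e == inr b then [:: (-1, t)] else [::]).
split; last first.
  rewrite (bigD1 (inr b : edge Gam)) //= eqxx big1 ?addr0.
    rewrite /edge_div !big_cons !big_nil /= !addr0 subrr freegU0 subr0.
    by rewrite -freegUN.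
  by move=> e /negPf ->; rewrite edge_div0.
move=> e y /andP[y0 yl]; case: eqP => [ee|/eqP eb].
  move: yl; rewrite {}ee => yl.
  have -> : bridge_pos b (@epoint R Gam (inr b) 0) = 0.
    by rewrite /bridge_pos val_epoint lexx /= leqnn.
  have -> : bridge_pos b (epoint (inr b : edge Gam) y) = y.
    rewrite /bridge_pos val_epoint; case: (leP y 0) => y0'.
      by rewrite /= leqnn; lra.
    case: (ltP y) => yl' /=; first by rewrite eqxx.
    by rewrite ltnn; apply: le_anti; rewrite yl yl'.
  rewrite /kinked big_seq1 /= mul1r [Num.min 0 t]min_l // add0r.
  by case: (leP y t) => yt; [rewrite max_l|rewrite max_r]; lra.
rewrite /kinked big_nil mul0r !addr0; congr Num.min.
rewrite /bridge_pos !val_epoint lexx; case: (leP y 0) => // y0'.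
case: e eb yl y0' => [[i d]|b'] /= eb yl y0'; first by case: ltP.
have {}eb : b' != b by apply: contra eb => /eqP ->.
have -> : (b' <= b)%N = (b' < b)%N by rewrite leq_eqVlt (negPf (eb : b' != b :> nat)).
by case: ltP => _ //=; rewrite (negPf eb).
Qed.

(** Every coordinate [pos i] vanishes at [vpt C base_cycle], which makes that point a suitable
    origin. *)
Definition base_cycle : 'I_g := Ordinal (genus_gt0 C).

(** The subtracted divisor depends only on the degree and the coordinates of [D], so this property
    for all [D] gives the injectivity of the Abel-Jacobi map. It is additive in [D] and thus need
    only be checked on points. *)
Definition aj_normal D : Prop :=
  principal (D - << deg D *g vpt C base_cycle >> - \sum_i theta i (aj i D)).

Lemma theta_sumD (s t : 'I_g -> R) :
  principal (\sum_i theta i (s i + t i) - \sum_i theta i (s i) - \sum_i theta i (t i)).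
Proof. by rewrite -2!sumrB; apply: principal_sum => i; exact: thetaD. Qed.

Lemma aj_normalD D D' : aj_normal D -> aj_normal D' -> aj_normal (D + D').
Proof.
move=> DP D'P; rewrite /aj_normal.
have := principalB (principalD DP D'P) (theta_sumD (fun i => aj i D) (fun i => aj i D')).
congr principal; rewrite degD -freegUD.
under [X in _ = _ - X]eq_bigr do rewrite raddfD.
move: (\sum_i _) (\sum_i _) (\sum_i _) => A B A'.
by apply/eqP/freeg_eqP => p; rewrite /= !(coeffD, coeffN); ring.
Qed.

Lemma aj_normalN D : aj_normal D -> aj_normal (- D).
Proof.
move=> DP; rewrite /aj_normal.
have := principalD (principalN DP) (theta_sumD (fun i => aj i D) (fun i => - aj i D)).
rewrite [X in _ + (X - _ - _)]big1 => [|i _]; last by rewrite subrr theta0.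
congr principal; rewrite degN -freegUN.
under [X in _ = _ - X]eq_bigr do rewrite raddfN.
move: (\sum_i _) (\sum_i _) => A B.
by apply/eqP/freeg_eqP => p; rewrite /= !(coeffD, coeffN, coeff0); ring.
Qed.

Lemma aj_normal_principal D : principal D -> aj_normal D.
Proof.
move=> DP; rewrite /aj_normal principal_deg // freegU0 subr0 big1 ?subr0 // => i _.
by rewrite (theta_eqmodr (principal_aj i DP)) theta0.
Qed.

Lemma aj_normal_circle x : ~~ on_bridge x ->
  aj_normal (<< x >> - << vpt C (cyc x) >>).
Proof.
move=> xb; rewrite /aj_normal degB !degU subrr freegU0 subr0.
have ajE i : aj i (<< x >> - << vpt C (cyc x) >>) = if i == cyc x then ppos x else 0.
  rewrite raddfB /= !dvalU !mul1r /pos.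
  have -> : cyc (vpt C (cyc x)) = cyc x by [].
  case: ltnP => [ix|xi]; last by case: eqP => _; rewrite ?subr0 ?subrr.
  by rewrite subrr -val_eqE /= ltn_eqF.
rewrite (bigD1 (cyc x)) //= ajE eqxx big1 => [|i ix]; last by rewrite ajE (negPf ix) theta0.
rewrite addr0 /theta cpt_itv ?ppos_itv // circle_pt_ppos // subrr; exact: principal0.
Qed.

(** Induction along the chain: from one cycle to the next, cross the cycle from its left to its
    right vertex and then the bridge. *)
Lemma aj_normal_vpt i : aj_normal << vpt C i >>.
Proof.
case: i => n; elim: n => [|n IHn] ng.
  have -> : Ordinal ng = base_cycle by apply/val_inj.
  rewrite /aj_normal degU subrr sub0r big1 ?oppr0; first exact: principal0.
  by move=> i _; rewrite dvalU mul1r /pos /= /ppos /= if_same theta0.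
have ng1 : (n < g.-1)%N by lia.
pose b := Ordinal ng1.
have -> : << vpt C (Ordinal ng) >> = << vpt C (left_cycle b) >>
    + (<< wpt C (left_cycle b) >> - << vpt C (left_cycle b) >>)
    - (<< wpt C (left_cycle b) >> - << @epoint R Gam (inr b) (@elen R Gam (inr b)) >>) :> divisor Gam.
  rewrite [_ + (_ - _)]addrC subrK opprB [_ + (_ - _)]addrC subrK epoint_ge //.
  by congr << vpt C _ >>; apply/val_inj.
apply: aj_normalD; first apply: aj_normalD.
- by have := IHn (ltnW ng); congr aj_normal; congr << vpt C _ >>; apply/val_inj.
- exact: (@aj_normal_circle (wpt C (left_cycle b))).
- apply/aj_normalN/aj_normal_principal/principal_bridge.
  by rewrite lexx (ltW (elen_gt0 _)).
Qed.

Lemma aj_normal_point x : aj_normal << x >>.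
Proof.
case/boolP: (on_bridge x) => [|xb]; last first.
  have -> : << x >> = << x >> - << vpt C (cyc x) >> + << vpt C (cyc x) >> :> divisor Gam
    by rewrite subrK.
  by apply: aj_normalD (aj_normal_circle xb) (aj_normal_vpt _).
rewrite /on_bridge; case xE: (val x) => [//|[[//|b] y]] _.
have := valP x; rewrite xE /= => /andP[y0 yl].
have -> : x = @epoint R Gam (inr b) y.
  by apply/val_inj; rewrite val_epoint leNgt y0 /= yl.
have -> : << @epoint R Gam (inr b) y >> = << vpt C (left_cycle b) >>
    + (<< wpt C (left_cycle b) >> - << vpt C (left_cycle b) >>)
    - (<< wpt C (left_cycle b) >> - << @epoint R Gam (inr b) y >>) :> divisor Gam.
  by rewrite [_ + (_ - _)]addrC subrK opprB [_ + (_ - _)]addrC subrK.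
apply: aj_normalD; first apply: aj_normalD.
- exact: aj_normal_vpt.
- exact: (@aj_normal_circle (wpt C (left_cycle b))).
- apply/aj_normalN/aj_normal_principal/principal_bridge.
  by rewrite (ltW y0) (ltW yl).
Qed.

Lemma aj_normalP D : aj_normal D.
Proof.
have nat_mul (n : nat) x : aj_normal << n%:Z *g x >>.
  elim: n => [|n IHn]; first by rewrite freegU0; apply/aj_normal_principal/principal0.
  by rewrite -addn1 PoszD -freegUD; apply: aj_normalD IHn (aj_normal_point x).
elim/freeg_ind_dom0: D => [|k x D _ _ IHD]; first exact/aj_normal_principal/principal0.
apply: aj_normalD IHD; case: k => n; first exact: nat_mul.
by rewrite NegzE -freegUN; exact: aj_normalN.
Qed.

(** Necessity is [principal_aj]; for sufficiency, the normal form of [D' - D] is 0. *)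
Theorem lin_equiv_aj D D' : lin_equiv D D' <->
  deg D = deg D' /\ forall i, eqmodr (clen C i) (aj i D) (aj i D').
Proof.
rewrite lin_equivE; split=> [DP|[degE ajE]].
  split; first by have := principal_deg DP; rewrite degB; lia.
  move=> i; apply: eqmodr_sym; have [k] := principal_aj i DP.
  by rewrite raddfB subr0 => kE; exists k.
have := aj_normalP (D' - D); rewrite /aj_normal degB degE subrr freegU0 subr0.
rewrite big1 ?subr0 // => i _; rewrite -[RHS](theta0 i); apply: theta_eqmodr.
rewrite raddfB; have [k kE] := eqmodr_sym (ajE i); exists k.
by rewrite subr0 -kE.
Qed.

End AbelJacobi.

(** * Ranks and Brill-Noether ranks *)

Lemma largest_or (A : int -> Prop) : largest A = -1 \/ A (largest A).
Proof.
rewrite /largest; case: xgetP => [m _ [Am _]|_]; [by right | by left].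
Qed.

(** The integers from [m] on are indexed by natural numbers, where a bounded inhabited predicate has
    a maximum; so [largest] does not fall back on its default value. *)
Lemma largest_ge (A : int -> Prop) (m M : int) :
  A m -> (forall n, A n -> n <= M) -> m <= largest A.
Proof.
move=> Am AM.
pose P n := `[< A (m + n%:Z) >].
have exP : exists n, P n by exists 0%N; apply/asboolP; rewrite addr0.
have PM n : P n -> (n <= `|M - m|)%N by move=> /asboolP/AM; lia.
case: (ex_maxnP exP PM) => k /asboolP Ak kmax.
rewrite /largest; case: xgetP => [n _ [_ nub]|noMax]; first exact: nub.
case: (noMax (m + k%:Z)); split=> // n An; have [|mn] := leP n m; first by lia.
have : P `|n - m|%N by apply/asboolP; rewrite (_ : m + _ = n) //; lia.
by move/kmax; lia.
Qed.

Section EffectiveDivisors.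
Variables (R : realType) (G : metricGraph R).
Implicit Types (l : seq (point G)) (x : point G) (D E : divisor G).

(** Effective divisors are handled as lists of points, so that containing [dsum l] amounts to
    extending the list [l]. *)
Definition dsum l : divisor G := \sum_(x <- l) << x >>.

Lemma dsum_cons x l : dsum (x :: l) = << x >> + dsum l.
Proof. exact: big_cons. Qed.

Lemma dsum_cat l l' : dsum (l ++ l') = dsum l + dsum l'.
Proof. exact: big_cat. Qed.

Lemma deg_dsum l : deg (dsum l) = (size l)%:Z.
Proof.
rewrite /dsum raddf_sum /=; elim: l => [|x l IHl]; first by rewrite big_nil.
by rewrite big_cons IHl degU /=; lia.
Qed.

Lemma dval_dsum phi l : dval phi (dsum l) = \sum_(x <- l) phi x.
Proof. by rewrite /dsum raddf_sum /=; apply: eq_bigr => x _; rewrite dvalU mul1r. Qed.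

Lemma effective_dsum l : effective (dsum l).
Proof.
move=> p; rewrite coeff0 /dsum raddf_sum /= sumr_ge0 // => x _.
by rewrite coeffU mul1r ler0n.
Qed.

Lemma effectiveP D : effective D -> exists l, D = dsum l.
Proof.
move=> D0; rewrite -[D]freeg_sumE; elim: (dom D) => [|x s [l lE]].
  by exists [::]; rewrite /dsum !big_nil.
have := D0 x; rewrite coeff0 => /gez0_abs cE.
exists (nseq `|coeff x D| x ++ l); rewrite dsum_cat -lE big_cons -{1}cE; congr (_ + _).
elim: `|coeff x D|%N => [|n IHn]; first by rewrite freegU0 /dsum big_nil.
by rewrite /= dsum_cons -IHn freegUD.
Qed.

Lemma effective_sub_dsum l D : effective (D - dsum l) -> exists l', D = dsum (l ++ l').
Proof. by case/effectiveP => l' DE; exists l'; rewrite dsum_cat -DE addrC subrK. Qed.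

Lemma lin_equiv_deg D D' : lin_equiv D D' -> deg D = deg D'.
Proof. by move/lin_equivE/principal_deg; rewrite degB; lia. Qed.

Variable x0 : point G.

(** The degree of [D] bounds the integers competing for the rank, so that their maximum exists. *)
Lemma rank_ge (r : nat) D :
  (forall l, size l = r -> exists l', lin_equiv D (dsum (l ++ l'))) -> r%:Z <= rank D.
Proof.
move=> DP; have [l' Dl'] := DP _ (size_nseq r x0).
have degD0 : 0 <= deg D by rewrite (lin_equiv_deg Dl') deg_dsum.
rewrite /rank asboolT; last by exists (dsum (nseq r x0 ++ l')) => //; exact: effective_dsum.
apply: (@largest_ge _ _ (deg D)).
  move=> E /effectiveP[l ->]; rewrite deg_dsum => -[/DP[l1 Dl1]].
  exists (dsum (l ++ l1)); split=> //; first exact: effective_dsum.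
  by rewrite dsum_cat addrC addKr; exact: effective_dsum.
move=> n; case: (leP n 0) => [|n0 nP]; first by lia.
have := nP (dsum (nseq `|n|%N x0)) (effective_dsum _).
rewrite deg_dsum size_nseq gez0_abs ?(ltW n0) // => /(_ erefl)[D' [DD' _]].
move=> /effective_sub_dsum[l1 D'E]; rewrite (lin_equiv_deg DD') D'E deg_dsum.
by rewrite size_cat size_nseq; lia.
Qed.

(** The rank may exceed 1; the test divisor is then that many copies of [x], of which one is singled
    out. *)
Lemma rank_ge1 D x : 1 <= rank D -> exists l, lin_equiv D (dsum (x :: l)).
Proof.
rewrite /rank; case: asboolP => // _; set A : int -> Prop := (X in largest X).
case: (largest_or A) => [->//|].
move: (largest A) => m /[swap] m1 /(_ (dsum (nseq `|m|%N x)) (effective_dsum _)).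
rewrite deg_dsum size_nseq gez0_abs; last lia.
move=> /(_ erefl)[D' [DD' _ /effective_sub_dsum[l D'E]]].
have mE : `|m|%N = `|m|.-1.+1 by lia.
by exists (nseq `|m|.-1 x ++ l); rewrite mE in D'E; rewrite -D'E.
Qed.

Lemma bn_rank_ge (r d w : nat) :
  (forall l, size l = (w + r)%N -> exists l',
     size (l ++ l') = d /\ r%:Z <= rank (dsum (l ++ l'))) ->
  w%:Z <= bn_rank G r d.
Proof.
move=> lP; have [l' [lsize lrank]] := lP _ (size_nseq _ x0).
rewrite /bn_rank asboolT; last first.
  by exists (dsum (nseq (w + r) x0 ++ l')); rewrite // deg_dsum lsize.
apply: (@largest_ge _ _ d%:Z).
  move=> E /effectiveP[l ->]; rewrite deg_dsum -PoszD => -[/lP[l1 [lsize1 lrank1]]].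
  exists (dsum (l ++ l1)); split=> //; first exact: effective_dsum.
    move=> p; have := effective_dsum l1 p; rewrite dsum_cat coeff0 coeffD; lia.
  by rewrite deg_dsum lsize1.
move=> n; case: (leP n 0) => [|n0 nP]; first by lia.
have := nP (dsum (nseq (`|n| + r)%N x0)) (effective_dsum _).
rewrite deg_dsum size_nseq PoszD gez0_abs ?(ltW n0) // => /(_ erefl)[D [_ ED <- _]].
have /effective_sub_dsum[l1 ->] : effective (D - dsum (nseq (`|n| + r)%N x0)).
  by move=> p; rewrite coeff0 coeffB subr_ge0; exact: ED.
by rewrite deg_dsum size_cat size_nseq; lia.
Qed.

(** A Brill-Noether rank [m >= w] would apply to [l] padded with [m - w] copies of [x0]. *)
Lemma bn_rank_lt (r d w : nat) l : size l = (w + r)%N ->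
  (forall l', size (l ++ l') = d -> rank (dsum (l ++ l')) < r%:Z) ->
  bn_rank G r d < w%:Z.
Proof.
move=> lsize lP; rewrite ltNge; apply/negP; rewrite /bn_rank; case: asboolP => // _.
set A : int -> Prop := (X in largest X).
case: (largest_or A) => [->//|].
move: (largest A) => m /[swap] wm; set n := `|m - w|%N.
move=> /(_ (dsum (l ++ nseq n x0)) (effective_dsum _)).
rewrite deg_dsum size_cat size_nseq lsize => /(_ ltac:(lia))[D [_ lD degD]].
have /effective_sub_dsum[l1 DE] : effective (D - dsum (l ++ nseq n x0)).
  by move=> p; rewrite coeff0 coeffB subr_ge0; exact: lD.
move: degD; rewrite DE -catA deg_dsum => -[/lP]; lia.
Qed.

End EffectiveDivisors.

(** * Divisors on distinct cycles *)

Section Counting.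
Local Open Scope nat_scope.
Variable g : nat.
Implicit Types (S T : {set 'I_g}) (i j : 'I_g).

Definition above S i : nat := \sum_(j in S) (i < j).
(** The bound is a natural number and not a cycle, so that [below S g] counts all of [S]. *)
Definition below S (n : nat) : nat := \sum_(j in S) (j < n).

Lemma card_interval a n : (a + n <= g)%N -> #|[set i : 'I_g | (a <= i < a + n)%N]| = n.
Proof.
elim: n => [|n IHn] ang; first by apply: eq_card0 => i; rewrite !inE; apply/negbTE; lia.
have ang' : (a + n < g)%N by lia.
rewrite (_ : [set _ | _] = Ordinal ang' |: [set i : 'I_g | (a <= i < a + n)%N]).
  by rewrite cardsU1 IHn ?inE /=; lia.
by apply/setP => i; rewrite !inE -val_eqE /=; lia.
Qed.

Lemma sum_nat_card S (P : pred 'I_g) : \sum_(j in S) P j = #|[set j in S | P j]|.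
Proof. by rewrite -sum1dep_card [RHS]big_mkcondr. Qed.

Lemma aboveC S i : (above S i + above (~: S) i + i.+1 = g)%N.
Proof.
rewrite -[RHS](subnK (ltn_ord i)); congr (_ + _)%N.
rewrite -(@card_interval i.+1 (g - i.+1)) ?subnKC ?ltn_ord //.
rewrite /above !sum_nat_card -cardsUI (_ : _ :&: _ = finset.set0) ?cards0 ?addn0.
  by apply: eq_card => j; rewrite !inE; have := ltn_ord j; case: (j \in S); lia.
by apply/setP => j; rewrite !inE; case: (j \in S); rewrite ?andbF.
Qed.

Lemma above_below S i : i \in S -> (above S i + below S i).+1 = #|S|.
Proof.
move=> iS; rewrite /above /below -big_split /= (cardsD1 i) iS add1n; congr _.+1.
rewrite (big_setD1 i) //= ltnn !add0n -sum1_card; apply: eq_bigr => j.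
by rewrite !inE -val_eqE /=; case: ltngtP.
Qed.

Lemma aboveU1 S j i : j \notin S -> above (j |: S) i = ((i < j) + above S i)%N.
Proof. by move=> jS; rewrite /above big_setU1. Qed.

Lemma above1 i j : above [set j] i = (i < j)%N.
Proof. by rewrite /above big_set1. Qed.

Lemma above2 p q i : p != q -> above [set p; q] i = ((i < p) + (i < q))%N.
Proof. by move=> pq; rewrite aboveU1 ?above1 // inE. Qed.

Lemma aboveD S T i : T \subset S -> above S i = (above (S :\: T) i + above T i)%N.
Proof. by move=> TS; rewrite /above (big_setID T) /= (finset.setIidPr TS) addnC. Qed.

Lemma above_gt0 S i j : j \in S -> (i < j)%N -> (0 < above S i)%N.
Proof. by move=> jS ij; rewrite /above (big_setD1 j) //= ij. Qed.

Lemma below_gt0 S i j : j \in S -> (j < i)%N -> (0 < below S i)%N.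
Proof. by move=> jS ji; rewrite /below (big_setD1 j) //= ji. Qed.

Lemma above_gt0P S i : (0 < above S i)%N -> exists2 j, j \in S & (i < j)%N.
Proof.
rewrite lt0n /above sum_nat_eq0 => /forall_inPn[j jS]; rewrite eqb0 negbK.
by exists j.
Qed.

Lemma below_gt0P S (n : nat) : (0 < below S n)%N -> exists2 j, j \in S & (j < n)%N.
Proof.
rewrite lt0n /below sum_nat_eq0 => /forall_inPn[j jS]; rewrite eqb0 negbK.
by exists j.
Qed.

Lemma belowS S i : below S i.+1 = (below S i + (i \in S))%N.
Proof.
have <- : \sum_(j in S) (j == i) = (i \in S).
  case: (boolP (i \in S)) => iS.
    by rewrite (big_setD1 i) //= eqxx big1 // => j; rewrite !inE => /andP[/negPf ->].
  by rewrite big1 // => j jS; case: eqP => // ji; rewrite -ji jS in iS.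
by rewrite -big_split; apply: eq_bigr => j _ /=; rewrite ltnS leq_eqVlt -val_eqE; case: ltngtP.
Qed.

(** Discrete intermediate values: [a] precedes the least [n] for which [below S n] exceeds the count
    of [s] plus [c], so that passing [a] raises the former only. The last clause serves to order the
    crossings for [c = 0] and [c = 1]. *)
Lemma exists_crossing S (s : seq 'I_g) c : (size s + c < #|S|)%N ->
  exists a : 'I_g, [/\ a \in S, a \notin s,
    (count (fun i : 'I_g => i < a) s + c = below S a)%N &
    forall n, (n <= a)%N -> (below S n <= count (fun i : 'I_g => i < n) s + c)%N].
Proof.
move=> sS; pose P n := count (fun i : 'I_g => i < n) s + c < below S n.
have Pg : P g.
  rewrite /P (_ : below S g = #|S|).
    by apply: leq_ltn_trans sS; rewrite leq_add2r count_size.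
  by rewrite -sum1_card; apply: eq_bigr => j _; rewrite ltn_ord.
case: (ex_minnP (ex_intro P g Pg)) => -[|n] Pn nmin.
  by move: Pn; rewrite /P /below big1.
have ng : n < g by exact: nmin.
pose a := Ordinal ng.
have leP m : m <= a -> below S m <= count (fun i : 'I_g => i < m) s + c.
  by move=> ma; rewrite leqNgt; apply/negP => /nmin; rewrite ltnNge ma.
exists a.
have cntS : count (fun i : 'I_g => i < n.+1) s =
    count (fun i : 'I_g => i < n) s + count_mem a s.
  rewrite -count_predUI [X in _ + X](_ : _ = 0) ?addn0; last first.
    apply/eqP; rewrite eqn0Ngt -has_count; apply/hasPn => i _ /=.
    by rewrite -val_eqE /=; case: ltngtP.
  by apply: eq_count => i /=; rewrite ltnS leq_eqVlt orbC -val_eqE.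
have := leP n (leqnn _); move: Pn.
rewrite /P -[X in below S X]/((val a).+1) belowS cntS -[below S n]/(below S (val a)).
rewrite -has_pred1 has_count /= => lt1 le1.
have aS : a \in S by case: (a \in S) lt1 => //; lia.
by split=> //; rewrite aS in lt1; lia.
Qed.

Lemma exists_subset (A B : {set 'I_g}) n :
  A \subset B -> (#|A| <= n <= #|B|)%N ->
  exists S, [/\ A \subset S, S \subset B & #|S| = n].
Proof.
move=> AB /andP[An nB]; pose s := take (n - #|A|) (enum (B :\: A)).
have sBA x : x \in s -> x \in B :\: A by move/mem_take; rewrite mem_enum.
have cBA : #|B :\: A| = (#|B| - #|A|)%N by rewrite cardsD (finset.setIidPr AB).
exists (A :|: [set x in s]); split; first exact: finset.subsetUl.
  rewrite finset.subUset AB /=; apply/fintype.subsetP => x; rewrite inE => /sBA.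
  by rewrite inE => /andP[].
rewrite cardsU (_ : _ :&: _ = finset.set0).
  rewrite cards0 subn0 cardsE (card_uniqP _) ?take_uniq ?enum_uniq //.
  by rewrite size_takel -?cardE ?cBA; lia.
by apply/setP => x; rewrite !inE; apply/negP => /andP[xA /sBA]; rewrite inE xA.
Qed.

(* [bad] holds at the cycles whose torsion is not 2, which may only be
   extremal in the set [S]. *)
Lemma exists_good_set (r : nat) (bad : pred 'I_g) (p q : 'I_g) :
  (p < q)%N -> (2 * r + 3 <= g)%N ->
  (forall i, bad i -> (r < i)%N /\ (i + r.+1 < g)%N) ->
  (forall i j, bad i -> bad j -> (i < j)%N -> (i + r.+1 <= j)%N) ->
  exists S, [/\ #|S| = r.+2, p \in S, q \in S &
    forall i j k, i \in S -> j \in S -> k \in S -> (i < j < k)%N -> ~~ bad j].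
Proof.
move=> pq rg bad_itv bad_gap.
have [bp|nbp] := boolP (bad p).
  have [rp pr] := bad_itv _ bp.
  have mg : (maxn q (p + r.+1) < g)%N by rewrite gtn_max ltn_ord.
  (* The next bad cycle after [p] is at least [r.+1] further, so it can only be the last element.
     That element is [q] itself unless [q] already lies in the interval. *)
  exists (Ordinal mg |: [set i : 'I_g | (p <= i < p + r.+1)%N]).
  split; rewrite ?cardsU1 ?card_interval ?inE -?val_eqE /=; try lia.
  move=> i j k; rewrite !inE -!val_eqE /= => iP jP kP ijk.
  by apply/negP => /(bad_gap _ _ bp); lia.
have [bq|nbq] := boolP (bad q).
  have [rq qr] := bad_itv _ bq.
  have mg : (minn p (q - r.+1) < g)%N by have := ltn_ord q; lia.
  exists (Ordinal mg |: [set i : 'I_g | (q - r <= i < q - r + r.+1)%N]).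
  split; rewrite ?cardsU1 ?card_interval ?inE -?val_eqE /=; try lia.
  move=> i j k; rewrite !inE -!val_eqE /= => iP jP kP ijk.
  by apply/negP => /bad_gap /(_ bq); lia.
have [||S [pqS SB Sr]] := @exists_subset [set p; q] [set i | ~~ bad i] r.+2.
- by apply/fintype.subsetP => i /set2P[] ->; rewrite inE.
- rewrite cards2; apply/andP; split; first by case: (p != q).
  have g1 : (g.-1 < g)%N by lia.
  (* The first [r.+1] cycles and the last one are never bad, which gives enough cycles to choose
     from. *)
  rewrite -[X in (X <= _)%N](_ : #|Ordinal g1 |: [set i : 'I_g | (0 <= i < 0 + r.+1)%N]| = _).
    apply/subset_leq_card/fintype.subsetP => i; rewrite !inE -val_eqE /= => iP.
    by apply/negP => /bad_itv; lia.
  by rewrite cardsU1 card_interval ?inE /=; lia.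
exists S; split=> //; rewrite ?(fintype.subsetP pqS) ?set21 ?set22 //.
by move=> i j k _ /(fintype.subsetP SB); rewrite inE.
Qed.

End Counting.

(** * Divisors with one point on each cycle of a set *)

Section ChainDivisors.
Variables (R : realType) (g : nat) (C : chain_of_cycles R g).
Local Notation Gam := (chain_graph C).
Implicit Types (i j : 'I_g) (x : point Gam) (t : R) (D : divisor Gam).
Implicit Types (S T : {set 'I_g}) (y : 'I_g -> R) (l : seq (point Gam)).
Local Notation aj i := (dval (@pos R g C i)).

Definition cycle_pts T y : seq (point Gam) := [seq cpt C i (y i) | i <- enum T].

Lemma size_cycle_pts T y : size (cycle_pts T y) = #|T|.
Proof. by rewrite size_map cardE. Qed.

Lemma pos_neq i x : i != cyc x -> pos i x = carc C i *+ (i < cyc x)%N.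
Proof. by rewrite /pos => /negPf ->; case: ltnP. Qed.

(** Seen from cycle [i], a point on a later cycle sits at the end of the arc and a point on an
    earlier cycle at its origin. *)
Lemma aj_cycle_pts T y i : eqmodr (clen C i) (aj i (dsum (cycle_pts T y)))
  ((if i \in T then y i else 0) + carc C i *+ above T i).
Proof.
rewrite dval_dsum big_map -mulr_natr natr_sum mulr_sumr.
have -> : (if i \in T then y i else 0) = \sum_(j <- enum T) (if j == i then y i else 0).
  rewrite big_enum /=; case: ifPn => iT.
    by rewrite (bigD1 i) //= eqxx big1 ?addr0 // => j /andP[_ /negPf ->].
  by rewrite big1 // => j jT; case: eqP => // ji; rewrite ji (negPf iT) in jT.
rewrite -[X in _ + X]big_enum -big_split /=; apply: eqmodr_sum => j.
have [->|ji] := eqVneq j i.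
  by rewrite ltnn mulr0 addr0; exact: pos_cpt.
by rewrite pos_neq cyc_cpt 1?eq_sym // add0r mulr_natr; exact: eqmodr_refl.
Qed.

(** On the cycles of [T] the coordinates can be solved for one by one, so only the degree and the
    cycles outside [T] impose conditions. *)
Lemma equiv_cycle_pts D T : deg D = #|T|%:Z ->
  (forall i, i \notin T -> eqmodr (clen C i) (aj i D) (carc C i *+ above T i)) ->
  exists y, lin_equiv D (dsum (cycle_pts T y)).
Proof.
move=> degD DP; exists (fun i => aj i D - carc C i *+ above T i).
apply/lin_equiv_aj; split; first by rewrite deg_dsum size_cycle_pts.
move=> i; apply: eqmodr_sym; apply: eqmodr_trans (aj_cycle_pts _ _ _) _.
case: ifPn => [_|iT]; first by rewrite subrK; exact: eqmodr_refl.
by rewrite add0r; apply: eqmodr_sym; exact: DP.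
Qed.

(* The cycle [f] is where a further chip at [x] can be moved to. *)
Lemma exists_free_cycle T x : (#|T| < g)%N ->
  exists2 f, f \notin T &
    forall i, i \notin T -> i != f -> pos i x = carc C i *+ (i < f)%N.
Proof.
move=> Tg.
have [f0 f0T] : exists f, f \notin T.
  have : (0 < #|~: T|)%N by rewrite cardsCs finset.setCK card_ord subn_gt0.
  by case/card_gt0P => f; rewrite inE; exists f.
(* Take the first free cycle from [cyc x] on, or else the last free cycle before it: no other free
   cycle then separates [x] from [f]. *)
have [/existsP[f1 /andP[f1T xf1]]|] :=
    boolP [exists f, (f \notin T) && (cyc x <= f)%N].
  case: (@arg_minnP _ f1 (fun f => (f \notin T) && (cyc x <= f)%N) (fun f => f : nat)).
    by rewrite f1T.
  move=> f /andP[fT xf] fmin; exists f => // i iT iNf.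
  have [ix|xi] := ltnP i (cyc x).
    by rewrite pos_lt // (leq_trans ix xf).
  have fi : (f < i)%N.
    by rewrite ltn_neqAle fmin ?iT // andbT eq_sym.
  by rewrite pos_gt ?(leq_ltn_trans xf) // ltnNge ltnW.
rewrite negb_exists => /forallP noge.
case: (@arg_maxnP _ f0 (fun f => f \notin T) (fun f => f : nat) f0T) => f fT fmax.
exists f => // i iT iNf.
have lt_if : (i < f)%N by rewrite ltn_neqAle; apply/andP; split; [exact: iNf | exact: fmax].
rewrite lt_if pos_lt //.
by have := noge f; rewrite fT /= -ltnNge; exact: ltn_trans.
Qed.

(** Chips are added one at a time. The cycles still free see the new chip on the same side as the
    cycle [f], so [f] joins [T] and the points on [T] are readjusted. *)
Lemma equiv_distinct_cycles l : (size l <= g)%N ->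
  exists T y, #|T| = size l /\ lin_equiv (dsum l) (dsum (cycle_pts T y)).
Proof.
elim: l => [_|x l IHl lg].
  exists finset.set0, (fun=> 0); split; first by rewrite cards0.
  rewrite /cycle_pts enum_set0; apply/lin_equiv_aj; split=> // i; exact: eqmodr_refl.
have [T [y [Tl /lin_equiv_aj[_ ly]]]] := IHl (ltnW lg).
have [|f fT fP] := @exists_free_cycle T x; first by rewrite Tl.
exists (f |: T).
have cardT : #|f |: T| = (size l).+1 by rewrite cardsU1 fT Tl.
have [||y' ly'] := @equiv_cycle_pts (dsum (x :: l)) (f |: T).
- by rewrite deg_dsum cardT.
- move=> i; rewrite !inE negb_or => /andP[iNf iT].
  rewrite dsum_cons raddfD /= dvalU mul1r fP // aboveU1 // mulrnDr.
  apply: eqmodrD; first exact: eqmodr_refl.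
  by apply: eqmodr_trans (ly i) _; have := aj_cycle_pts T y i; rewrite (negPf iT) add0r.
by exists y'.
Qed.

End ChainDivisors.

(** * A sufficient condition for rank at least [r] *)

Section LargeRank.
Variables (R : realType) (g : nat) (C : chain_of_cycles R g).
Local Notation Gam := (chain_graph C).
Implicit Types (i j : 'I_g) (x : point Gam) (t : R) (D : divisor Gam).
Implicit Types (S T : {set 'I_g}) (y : 'I_g -> R) (l : seq (point Gam)).
Local Notation aj i := (dval (@pos R g C i)).

Definition antipodal i : Prop := clen C i = carc C i *+ 2.

(** The arc is positive and at most half of the circle, so twice its length lies in the interval
    from 0 to [clen C i]; this forces [k = 1]. *)
Lemma antipodalP i (k : int) : k%:~R * clen C i = carc C i *+ 2 -> antipodal i.
Proof.
have := carc_gt0 C i; have := carc_le C i; rewrite /antipodal mulr2n => a1 a0 kE.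
have k0 : 0 < k by rewrite -(ltr_int R) -(pmulr_lgt0 _ (clen_gt0 C i)) kE; lra.
have k2 : k < 2.
  rewrite -(ltr_int R) -(ltr_pM2r (clen_gt0 C i)) kE.
  by have := clen_gt0 C i; lra.
by move: kE; rewrite (_ : k = 1) ?mul1r //; lia.
Qed.

Lemma eqmodr_antipodal i (n : int) (s t : R) :
  s - t = carc C i * (n * 2)%:~R -> n = 0 \/ antipodal i -> eqmodr (clen C i) s t.
Proof.
move=> st [n0|iA]; first by exists 0; rewrite st n0 mul0r mulr0 mul0r.
by exists n; rewrite st iA mulr2n rmorphM /=; ring.
Qed.

(** Turns congruences into chip counting: at an antipodal cycle only the parity of the numbers of
    chips matters, elsewhere they must balance exactly. *)
Lemma eqmodr_arc i (m1 m2 m3 : nat) (n : int) :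
  m1%:Z - m2%:Z - m3%:Z = n * 2 -> n = 0 \/ antipodal i ->
  eqmodr (clen C i) (carc C i *+ m1 - carc C i *+ m2) (carc C i *+ m3).
Proof.
move=> mn; apply: eqmodr_antipodal.
by rewrite -mn !rmorphB /= !mulrBr -(mulr_natr _ m1) -(mulr_natr _ m2) -(mulr_natr _ m3).
Qed.

Lemma aj_dsum_off i l : i \notin [seq cyc x | x <- l] ->
  aj i (dsum l) = carc C i *+ count (fun j => i < j)%N [seq cyc x | x <- l].
Proof.
rewrite dval_dsum; elim: l => [|x l IHl]; first by rewrite big_nil.
rewrite inE negb_or => /andP[ix il]; rewrite big_cons IHl //= pos_neq //.
by rewrite -mulrnDr.
Qed.

Definition inner_antipodal S : Prop := forall i j k,
  i \in S -> j \in S -> k \in S -> (i < j < k)%N -> antipodal j.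

Lemma inner_below S i : inner_antipodal S -> i \in S ->
  (0 < above S i)%N -> (0 < below S i)%N -> antipodal i.
Proof.
move=> SA iS /above_gt0P[k kS ik] /below_gt0P[j jS ji].
by apply: (SA j i k) => //; rewrite ji ik.
Qed.

Lemma count_lt_gt i (s : seq 'I_g) : i \notin s ->
  (count (fun j => i < j) s + count (fun j => j < i) s = size s)%N.
Proof.
elim: s => //= j s IHs; rewrite inE negb_or -val_eqE /= => /andP[ij /IHs <-].
by case: ltngtP ij => //= _ _; lia.
Qed.

(* An effective divisor [E] of degree [r] misses two cycles [a < b] of [S] at
   which the number of chips of [E] to the left equals, resp. is one less than,
   the number of cycles of [S] to the left; then [D - E] is equivalent to a sum of
   one point on each cycle other than [a] and [b]. *)
Lemma rank_ge_of_aj r S D : #|S| = r.+2 -> inner_antipodal S ->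
  (deg D = g%:Z + r%:Z - 2) ->
  (forall i, i \in S -> eqmodr (clen C i) (aj i D)
     (carc C i *+ (above (~: S) i + (below S i == 0) * (2 * r))%N)) ->
  r%:Z <= rank D.
Proof.
move=> cS SA degD ajD; apply: (rank_ge (vpt C (base_cycle C))) => l lr.
pose s := [seq cyc x | x <- l].
have ss : size s = r by rewrite size_map.
have [|a [aS al acnt aleft]] := @exists_crossing _ S s 0; first by rewrite ss cS; lia.
have [|b [bS bl bcnt _]] := @exists_crossing _ S s 1; first by rewrite ss cS; lia.
have ab : (a < b)%N by rewrite ltnNge; apply/negP => /aleft; lia.
have abN : a != b by apply: contraL ab => /eqP ->; rewrite ltnn.
pose T := ~: [set a; b].
have cT : (#|T| + 2 = g)%N.
  by have := cardsC [set a; b]; rewrite cards2 abN card_ord addnC.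
have aS0 : (0 < above S a)%N by exact: above_gt0 bS ab.
have bS0 : (0 < below S b)%N by exact: below_gt0 aS ab.
have [||y Dy] := @equiv_cycle_pts _ _ C (D - dsum l) T.
- by rewrite degB degD deg_dsum lr; move: cT; move: #|T| => n cT; clear -cT; lia.
- move=> i; rewrite inE negbK => /set2P[] ->; rewrite raddfB /= aj_dsum_off // -/s.
  + apply: eqmodr_trans (eqmodrB (ajD a aS) (eqmodr_refl _ _)) _.
    have := above_below aS; have := aboveC S a; have := aboveC [set a; b] a.
    have := count_lt_gt al; rewrite cS ss above2 // ltnn ab -/T.
    have := inner_below SA aS aS0; move: acnt.
    set u1 := count _ s; set u2 := count _ s; move: (below S a) (above _ a) (above _ a) (above _ a).
    clear; move=> be ab1 ab2 ab3 E1 A E2 E3 E4 E5.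
    (* Either [a] is the first cycle of [S], where the [2 * r] chips make the counts balance
       exactly, or it is interior to [S] and antipodal. *)
    case: (posnP be) A => [be0 _|be0 /(_ isT) A].
      by apply: (@eqmodr_arc _ _ _ _ 0); [lia | left].
    by apply: (@eqmodr_arc _ _ _ _ (be%:Z - r%:Z)); [lia | right].
  + apply: eqmodr_trans (eqmodrB (ajD b bS) (eqmodr_refl _ _)) _.
    have := above_below bS; have := aboveC S b; have := aboveC [set a; b] b.
    have := count_lt_gt bl; rewrite cS ss above2 // ltnn ltnNge (ltnW ab) -/T.
    have := inner_below SA bS; rewrite bS0 (gtn_eqF bS0); move: bcnt.
    set u1 := count _ s; set u2 := count _ s; move: (below S b) (above _ b) (above _ b) (above _ b).
    clear; move=> be ab1 ab2 ab3 E1 A E2 E3 E4 E5.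
    (* Here [ab3] is [above S b]: it is 0 if [b] is the last cycle of [S], and otherwise [b] is
       antipodal. *)
    apply: (@eqmodr_arc _ _ _ _ (- ab3%:Z)); first lia.
    by case: (posnP ab3) A => [->|ab0 /(_ isT isT)]; [left | right].
exists (cycle_pts C T y).
apply/lin_equivE; move/lin_equivE: Dy; congr principal.
by rewrite opprB addrA dsum_cat [dsum l + _]addrC.
Qed.

End LargeRank.

(** * Containment in divisors of prescribed rank *)

Section Containment.
Variables (R : realType) (g : nat) (C : chain_of_cycles R g).
Local Notation Gam := (chain_graph C).
Implicit Types (i j : 'I_g) (x : point Gam) (t : R) (D : divisor Gam).
Implicit Types (S T : {set 'I_g}) (y : 'I_g -> R) (l : seq (point Gam)).
Local Notation aj i := (dval (@pos R g C i)).

Lemma set2_lt T : #|T| = 2%N -> exists p q : 'I_g, (p < q)%N /\ T = [set p; q].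
Proof.
move/eqP/cards2P => [p [q [pq ->]]].
have [lt|lt] := ltnP p q; first by exists p, q.
exists q, p; split; last by rewrite finset.setUC.
by rewrite ltn_neqAle lt andbT eq_sym.
Qed.

(** The chips of [l] are spread over all cycles but [p] and [q]. The added points adjust the other
    cycles of [S] to the hypothesis of [rank_ge_of_aj]; at [p] and [q] that hypothesis holds by
    counting chips. *)
Lemma contained_in_rank_ge r l :
  (forall p q : 'I_g, (p < q)%N ->
     exists S, [/\ #|S| = r.+2, p \in S, q \in S & inner_antipodal C S]) ->
  (size l + 2)%N = g ->
  exists l', size (l ++ l') = (size l + r)%N /\ r%:Z <= rank (dsum (l ++ l')).
Proof.
move=> exS lg.
have [|T [y [Tl /lin_equiv_aj[_ ly]]]] := @equiv_distinct_cycles _ _ C l; first by lia.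
have [|p [q [pq TpqC]]] := @set2_lt (~: T).
  by have := cardsC T; rewrite card_ord Tl; move: #|_| => n; lia.
have [S [cS pS qS SA]] := exS p q pq.
have pqN : p != q by apply: contraL pq => /eqP ->; rewrite ltnn.
have pqS : [set p; q] \subset S by apply/fintype.subsetP => i /set2P[] ->.
pose S' := S :\: [set p; q].
pose tgt i := (above (~: S) i + (below S i == 0) * (2 * r))%N.
(* Solved from the requirement that the points on cycle [i] and the arcs due to later points add up
   to [tgt i] arcs. *)
pose eta i := carc C i *+ tgt i - y i - carc C i *+ above T i - carc C i *+ above S' i.
have S'r : #|S'| = r by rewrite cardsD (finset.setIidPr pqS) cS cards2 pqN; lia.
exists (cycle_pts C S' eta); rewrite size_cat size_cycle_pts S'r; split=> //.
apply: (rank_ge_of_aj cS SA).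
  by rewrite deg_dsum size_cat size_cycle_pts S'r; lia.
move=> i iS; rewrite dsum_cat raddfD /=.
apply: eqmodr_trans (eqmodrD (eqmodr_trans (ly i) (aj_cycle_pts _ _ _ _)) (aj_cycle_pts _ _ _ _)) _.
have TE k : (k \in T) = (k \notin [set p; q]) by rewrite -TpqC inE negbK.
rewrite TE !inE iS andbT; case: ifPn => [_|].
  rewrite -/(tgt i) (_ : _ + _ = carc C i *+ tgt i); first exact: eqmodr_refl.
  by rewrite /eta; lra.
rewrite negbK => ipq; rewrite !add0r -mulrnDr -[_ *+ (_ + above S' i)]subr0 -(mulr0n (carc C i)).
have := inner_below SA iS; have := above_below iS; have := aboveC S i.
have := aboveC T i; have := aboveD i pqS; rewrite cS TpqC above2 //.
(* As [p] and [q] both lie in [S], [p] is the first cycle of [S] or antipodal, and [q] is the last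
   one or antipodal. *)
case/orP: ipq => /eqP ->; rewrite ?ltnn ?pq ?[(q < p)%N]ltnNge ?(ltnW pq).
  have := above_gt0 qS pq.
  move: (below S p) (above _ p) (above _ p) (above _ p) (above _ p).
  clear => be ab1 ab2 ab3 ab4 A0 E1 E2 E3 E4 A.
  case: (posnP be) A => [be0 _|be0 /(_ A0 isT) A].
    by apply: (@eqmodr_arc _ _ _ _ _ _ _ 0); [lia | left].
  by apply: (@eqmodr_arc _ _ _ _ _ _ _ (ab4%:Z - 1)); [lia | right].
have := below_gt0 pS pq.
move: (below S q) (above _ q) (above _ q) (above _ q) (above _ q).
clear => be ab1 ab2 ab3 ab4 A0 E1 E2 E3 E4 A.
apply: (@eqmodr_arc _ _ _ _ _ _ _ ab4%:Z); first by rewrite (gtn_eqF A0); lia.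
by case: (posnP ab4) A => [->|ab0 /(_ isT A0)]; [left | right].
Qed.

Lemma exists_notin (s : seq R) (a b : R) : a < b -> exists2 z, a < z < b & z \notin s.
Proof.
elim: s a b => [|x s IHs] a b ab; first by exists ((a + b) / 2) => //; lra.
have [xab|xab] := boolP (a < x < b).
  have [|z zax zs] := IHs a x; first by lra.
  exists z; first lra.
  by rewrite inE negb_or zs andbT lt_eqF //; lra.
have [z zab zs] := IHs a b ab; exists z => //.
by rewrite inE negb_or zs andbT; apply: contraNneq xab => <-.
Qed.

(** The excluded values are those that chips lying off cycle [i] can produce there; up to congruence
    they are finitely many. *)
Lemma exists_generic i (n : nat) : exists z : R,
  forall k : int, (`|k| <= n)%N -> ~ eqmodr (clen C i) z (carc C i * k%:~R).
Proof.
pose s := [seq redmod (clen C i) (carc C i * (m%:Z - n%:Z)%:~R) | m <- iota 0 (n + n).+1].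
have [z zl zs] := exists_notin s (clen_gt0 C i).
exists z => k kn zk; case/negP: zs; apply/mapP; exists (absz (k + n%:Z)).
  by rewrite mem_iota; lia.
rewrite -[LHS](redmod_id (clen_gt0 C i)); last by lra.
rewrite (redmod_eq (clen_gt0 C i) zk); congr (redmod _ (_ * _%:~R)); lia.
Qed.

Lemma count_above T i : count (fun j => i < j)%N (enum T) = above T i.
Proof.
by rewrite /above -sum1_count big_mkcond big_enum; apply: eq_bigr => j _; case: ltnP.
Qed.

(* If [x] lies on one side of the non-antipodal cycle [j], no chip can be moved
   to a generic point of the neighbour [c] of [j] on the other side: two chips
   can be brought to [j], but they cannot pass it together. *)
Lemma not_contained_in_rank_ge1 r j : (2 <= r)%N -> (r + 1 < g)%N ->
  (0 < j)%N -> (j.+1 < g)%N -> ~ antipodal C j ->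
  exists l, (size l + r + 1)%N = g /\ forall x, rank (dsum (rcons l x)) < 1.
Proof.
move=> r2 rg j0 jg jA.
have j1g : (j.-1 < g)%N by have := ltn_ord j; lia.
pose c0 := Ordinal j1g; pose c1 := Ordinal jg.
(* Since [r >= 2], there remain [g - r - 1] cycles besides [j] and its two neighbours. *)
have [||N [_ NB cN]] := @exists_subset _ finset.set0 (~: [set c0; j; c1]) (g - r - 1).
- exact: finset.sub0set.
- rewrite cards0 /=; have := cardsC [set c0; j; c1]; rewrite card_ord.
  have : (#|[set c0; j; c1]| <= 3)%N by rewrite !cardsU !cards1; lia.
  by move: #|_| #|_| => m n; clear -r2 rg; lia.
have notN i : i \in [set c0; j; c1] -> i \notin N.
  by apply: contraL => /(fintype.subsetP NB); rewrite inE.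
have jN : j \notin N by apply: notN; rewrite !inE eqxx orbT.
(* The bound [g + 2] exceeds every difference of chip counts that arises below. *)
have /boolp.choice[z zP] i := exists_generic i (g + 2).
exists (cycle_pts C N z); split; first by rewrite size_cycle_pts cN; lia.
move=> x; rewrite ltNge; apply/negP => rank1.
pose c := if (cyc x <= j)%N then c1 else c0.
have cN' : c \notin N by apply: notN; rewrite /c; case: ifP; rewrite !inE eqxx ?orbT.
have cx : c != cyc x.
  by rewrite /c; case: (leqP (cyc x) j) => xj; rewrite -val_eqE /=; lia.
have jc : (j < c)%N = (cyc x <= j)%N by rewrite /c; case: (leqP (cyc x) j) => xj /=; rewrite ?ltnSn // ltnNge leq_pred.
have cj : c != j by rewrite /c; case: (leqP (cyc x) j) => xj; rewrite -val_eqE /=; lia.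
have [l' /lin_equiv_aj[]] := rank_ge1 (cpt C c (z c)) rank1.
rewrite !deg_dsum /= size_rcons size_cycle_pts => -[sl'] ajE.
pose s := [seq cyc x | x <- l'].
have ss : size s = #|N| by rewrite size_map sl'.
have abN i : (above N i <= g)%N by have := aboveC N i; lia.
have cnt_le i : (count (fun k : 'I_g => i < k) s <= g)%N.
  by apply: leq_trans (count_size _ _) _; rewrite ss cN; lia.
have ajL i : i != cyc x -> eqmodr (clen C i) (aj i (dsum (rcons (cycle_pts C N z) x)))
    ((if i \in N then z i else 0) + carc C i *+ (above N i + (i < cyc x)%N)).
  move=> ix; rewrite -cats1 dsum_cat raddfD /= dval_dsum [dval _ _]dval_dsum big_seq1 pos_neq //.
  rewrite mulrnDr addrA -dval_dsum; apply: eqmodrD; last exact: eqmodr_refl.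
  exact: aj_cycle_pts.
have zN i m n : (m <= g + 2)%N -> (n <= g + 2)%N ->
    ~ eqmodr (clen C i) (z i + carc C i *+ m) (carc C i *+ n).
  move=> mg ng [k kE]; apply: (zP i (n%:Z - m%:Z)); first by lia.
  exists k; rewrite -kE rmorphB /= mulrBr !mulr_natr; lra.
(* The original divisor has a multiple of the arc as coordinate on [c], so another chip on [c] must
   compensate the generic one. *)
have cs : c \in s.
  apply/negP => /negP cs; apply: (@zN c (count (fun k : 'I_g => c < k) s)%N
    (above N c + (c < cyc x))%N).
  - by apply: leq_trans (cnt_le c) _; rewrite leq_addr.
  - by apply: leq_add (abN c) _; case: (c < _)%N.
  have := eqmodr_trans (eqmodr_sym (ajE c)) (ajL c cx).
  rewrite (negPf cN') add0r dsum_cons raddfD /= dvalU mul1r aj_dsum_off //.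
  apply: eqmodr_trans; apply: eqmodrD (eqmodr_refl _ _).
  exact/eqmodr_sym/pos_cpt.
(* Likewise the generic coordinate on a cycle of [N] not containing [x] can only be matched by a
   chip on that cycle. *)
have Ns i : i \in N -> i != cyc x -> i \in s.
  move=> iN ix; apply/negP => /negP is'.
  have ic : i \notin [seq cyc x' | x' <- cpt C c (z c) :: l'].
    by rewrite inE negb_or is' andbT cyc_cpt; apply: contraNneq cN' => <-.
  have := eqmodr_trans (eqmodr_sym (ajL i ix)) (ajE i).
  rewrite iN aj_dsum_off //; apply: zN.
    by apply: leq_add (abN i) _; case: (i < _)%N.
  by rewrite /= -/s addnC; apply: leq_add (cnt_le i) _; case: (i < _)%N.
(* If [x] lay on a cycle outside [N], the [#|N|] chips of [l'] would have to occupy [c] and all of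
   [N]. *)
have [xN|xN] := boolP (cyc x \in N); last first.
  have := @uniq_leq_size _ (c :: enum N) s.
  rewrite /= mem_enum cN' enum_uniq -cardE ss ltnn => /(_ isT) F.
  suff: false by []; apply: F => i; rewrite inE mem_enum => /predU1P[->//|iN].
  by apply: Ns => //; apply: contraNneq xN => <-.
(* No chip is left over: [l'] has exactly one chip on [c] and on each cycle of [N] other than that
   of [x]. *)
have perm_s : perm_eq s (c :: enum (N :\ cyc x)).
  have un : uniq (c :: enum (N :\ cyc x)).
    by rewrite /= mem_enum enum_uniq inE (negPf cN') andbF.
  have sub : {subset c :: enum (N :\ cyc x) <= s}.
    by move=> i; rewrite inE mem_enum !inE => /predU1P[->//|/andP[ix iN]]; exact: Ns.
  have sz : (size s <= size (c :: enum (N :\ cyc x)))%N.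
    by rewrite ss /= -cardE (cardsD1 (cyc x) N) xN.
  have [szE memE] := uniq_min_size un sub sz.
  rewrite perm_sym; apply: uniq_perm => //.
  by apply: leq_size_uniq un sub sz.
have jx : j != cyc x by apply: contraNneq jN => ->.
have js : j \notin [seq cyc x' | x' <- cpt C c (z c) :: l'].
  rewrite /= cyc_cpt -/s inE negb_or eq_sym cj (perm_mem perm_s) inE negb_or eq_sym cj.
  by rewrite mem_enum inE (negPf jN) andbF.
have := eqmodr_trans (eqmodr_sym (ajL j jx)) (ajE j).
rewrite (negPf jN) add0r aj_dsum_off //= cyc_cpt -/s.
rewrite (permP perm_s) /= count_above jc.
have -> : above N j = (above (N :\ cyc x) j + (j < cyc x))%N.
  by rewrite (@aboveD _ _ [set cyc x]) ?above1 // finset.sub1set.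
(* Comparing both divisors at [j], exactly two chips have passed from one side to the other, so
   twice the arc is a multiple of the circle. *)
case: (leqP (cyc x) j) => _ [k kE]; apply: jA; last first.
  by apply: (@antipodalP _ _ _ _ k); rewrite -kE !mulrnDr mulr0n mulr1n mulr2n; lra.
apply: (@antipodalP _ _ _ _ (- k)).
by rewrite rmorphN mulNr -kE !mulrnDr mulr0n mulr1n mulr2n; lra.
Qed.

End Containment.

(** * Torsion 2 and antipodal attaching points *)

Section Torsion.
Variables (R : realType) (g : nat) (C : chain_of_cycles R g).
Implicit Types i j : 'I_g.

Lemma torsion2_antipodal i : torsion C i.+1 = 2%N -> antipodal C i.
Proof.
(* Both the irrational case and the default of [xget] give 0, so the value 2 is attained by a
   genuine minimal multiple. *)
rewrite /torsion; case: asboolP => // _; case: xgetP => // m _ [[_ [k kE]] _] m2.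
by apply: (@antipodalP _ _ _ _ k); rewrite m2 in kE; rewrite -mulr_natl -[LHS]kE.
Qed.

Lemma antipodal_torsion2 i : antipodal C i -> torsion C i.+1 = 2%N.
Proof.
move=> iA; have a0 := carc_gt0 C i.
have lE : cycle_len C i.+1 = 2 * arc_len C i.+1.
  by rewrite -/(clen C i) iA mulr_natl.
rewrite /torsion asboolF; last first.
  apply; exists 2 => //; rewrite lE mulfK ?gt_eqF // ratr_nat //.
(* The multiple 1 is excluded: the circle being two arcs, it would make 1 an even integer. *)
have ge2 n : (0 < n)%N /\ (exists k : int, n%:R * arc_len C i.+1 = k%:~R * cycle_len C i.+1) ->
    (2 <= n)%N.
  case: n => [|[|n]] [// _ [k kE]] //.
  have : (k * 2)%:~R = 1 :> R.
    by apply: (mulIf (lt0r_neq0 a0)); rewrite rmorphM /= -mulrA -lE -kE.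
  by move/(@intr_inj R _ 1); lia.
have tm2 : (0 < 2)%N /\ (exists k : int, 2%:R * arc_len C i.+1 = k%:~R * cycle_len C i.+1).
  by split=> //; exists 1; rewrite mul1r lE.
apply: xget_unique => [|m [mm mmin]]; first by [].
by apply/eqP; rewrite eqn_leq mmin ?ge2.
Qed.

End Torsion.

(** * Comparison of the two Brill-Noether ranks *)

Theorem theorem6 (R : realType) (g r : nat) (C : chain_of_cycles R g)
    (hr : (2 <= r)%N) (hC : martens_special C r) :
  let d : int := g%:Z - 2 + r%:Z in
  bn_rank (chain_graph C) r%:Z d
    <> bn_rank (chain_graph C) (r%:Z - d + g%:Z - 1) (2 * g%:Z - 2 - d).
Proof.
move=> d; case: hC => k k1 [rg [s [sk /allP s_itv s_gap s_bad s_good]]].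
(* Ordinals number the cycles from 0, whereas [s] and [torsion] number them from 1. *)
pose bad (i : 'I_g) := i.+1 \in s.
have bad_itv i : bad i -> (r < i)%N /\ (i + r.+1 < g)%N by move/s_itv; lia.
have bad_gap i j : bad i -> bad j -> (i < j)%N -> (i + r.+1 <= j)%N.
  (* The gap relation is transitive, so it extends from consecutive entries of [s] to any two. *)
  move=> ib jb ij; have tr : transitive (fun m n => m + (r + 1) <= n)%N.
    by move=> ? ? ?; lia.
  have [lt|lt|eq] := ltngtP (index i.+1 s) (index j.+1 s).
  - by have := sorted_ltn_index tr s_gap _ _ ib jb lt; lia.
  - by have := sorted_ltn_index tr s_gap _ _ jb ib lt; lia.
  - by have := index_inj 0%N ib jb eq; lia.
have bad_antipodal i : bad i -> ~ antipodal C i.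
  by move=> /s_bad ib /antipodal_torsion2.
have exS (p q : 'I_g) : (p < q)%N -> exists S : {set 'I_g},
    [/\ #|S| = r.+2, p \in S, q \in S & inner_antipodal C S].
  move=> pq; have [S [cS pS qS Sbad]] := exists_good_set pq rg bad_itv bad_gap.
  exists S; split=> // i j l iS jS lS ijl; apply: torsion2_antipodal.
  (* Lying strictly between [i] and [l], the cycle [j] is neither the first nor the last, so its
     torsion is prescribed. *)
  by apply: s_good; [have := ltn_ord l; lia | exact: (Sbad i j l)].
have [j jb] : exists j : 'I_g, bad j.
  have [n ns] : exists n, n \in s.
    by case: (s) sk k1 => [<- //|n s' _ _]; exists n; exact: mem_head.
  have ng : (n.-1 < g)%N by have := s_itv n ns; lia.
  by exists (Ordinal ng); rewrite /bad /= prednK //; have := s_itv n ns; lia.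
have [r_lt_j j_lt] := bad_itv j jb.
pose x0 := vpt C (base_cycle C).
(* For [w = g - r - 2] the divisors to be contained have degree [w + r = g - 2]. *)
have w_le : (g - r - 2)%N%:Z <= bn_rank (chain_graph C) r d.
  rewrite /d (_ : _ - 2 + _ = (g + r - 2)%N%:Z); last by lia.
  apply: (bn_rank_ge x0) => l lsize.
  have [|l' [l'size l'rank]] := contained_in_rank_ge exS (l := l); first by lia.
  by exists l'; split=> //; lia.
have w_lt : bn_rank (chain_graph C) 1%N (g - r)%N < (g - r - 2)%N%:Z.
  have [|||||l [lsize lP]] := @not_contained_in_rank_ge1 _ _ C r j => //; try lia.
    exact: bad_antipodal.
  (* Here [l] has [g - r - 1] points, so a divisor of degree [g - r] containing it has just one
     further point. *)
  apply: (bn_rank_lt x0 (l := l)); first by lia.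
  move=> [|x [|x' l']]; rewrite size_cat /=; [lia | rewrite cats1 => _ | lia].
  exact: lP.
have -> : r%:Z - d + g%:Z - 1 = 1%N%:Z by rewrite /d; clear; lia.
have -> : 2 * g%:Z - 2 - d = (g - r)%N%:Z by rewrite /d; clear -rg; lia.
by move=> E; move: w_le; rewrite E leNgt w_lt.
Qed.
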